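(* Let $(X,d_X,\mu)$ and $(Y,d_Y,\nu)$ be metric measure spaces, let $1\le q<p<\infty$ with $\frac1\sigma=\frac1q-\frac1p$, and let $\varphi\colon X\to Y$ be a measurable mapping which induces the bounded composition operator $\varphi^{*}\colon D^{1,p}(Y)\cap\operatorname{Lip}(Y)\to D^{1,q}(X)$, $\varphi^*(u)=u\circ\varphi$. For open $U\subset Y$ put $\Phi(U)=\|\varphi^{*}\vert U\|^{\sigma}$, where $\varphi^*\vert U\colon D^{1,p}(U)\cap\overset{\circ}{\operatorname{Lip}}(U)\to D^{1,q}(X)$ is the restriction of $\varphi^*$, and for Borel $B\subset Y$ define $\Psi(B)$ by $$\Psi(B)^{\frac1\sigma}=\sup\bigg(\int_{\varphi^{-1}(B)}|\nabla_q(u\circ\varphi)|^q\,d\mu\bigg)^{\frac1q},$$ the supremum being over all $u\in\operatorname{Lip}(Y)$ with $\int_B|\nabla_p u|^p\,d\nu\le1$. Then $\Phi(U)=\Psi(U)$ for every open subset $U\subset Y$ of finite measure, $\nu(U)<\infty$.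
   Context: A metric measure space $(X,d_X,\mu)$ is a separable metric space $(X,d_X)$ with a nontrivial regular Borel measure $\mu$ that is finite on bounded sets. (Measures are outer measures for which Borel sets are measurable; regular Borel means every set is contained in a Borel set of the same measure.) For $1\le p<\infty$, $D^{1,p}(X)$ is the Dirichlet (homogeneous Sobolev) space of measurable functions $u\colon X\to\mathbb R$ having an upper gradient in $L^p(X,\mu)$; $|\nabla_p u|$ denotes the minimal $p$-weak upper gradient of $u$ (also for functions that are only locally in $D^{1,p}$). For open $U$, $D^{1,p}(U)$ is the same space on $U$. $\operatorname{Lip}(Y)$ is the space of Lipschitz functions $Y\to\mathbb R$. Lipschitz functions on $Y$ are locally in $D^{1,p}(Y)$, and for $u\in\operatorname{Lip}(Y)$ the gradient $|\nabla_q(u\circ\varphi)|$ is understood locally: on $\varphi^{-1}(G)$, $G\subset Y$ bounded open, it equals $|\nabla_q(v\circ\varphi)|$ a.e. for any $v\in D^{1,p}(Y)\cap\operatorname{Lip}(Y)$ with $v=u$ on $G$. $\varphi$ induces the bounded composition operator $\varphi^*\colon D^{1,p}(Y)\cap\operatorname{Lip}(Y)\to D^{1,q}(X)$ if $u\circ\varphi\in D^{1,q}(X)$ for every $u\in D^{1,p}(Y)\cap\operatorname{Lip}(Y)$ and there is a constant $C<\infty$ with $\big(\int_X|\nabla_q(u\circ\varphi)|^q\,d\mu\big)^{1/q}\le C\big(\int_Y|\nabla_p u|^p\,d\nu\big)^{1/p}$ for all such $u$. For open $U\subset Y$, $\overset{\circ}{\operatorname{Lip}}(U)$ is the space of Lipschitz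 functions $u$ on $Y$ with $\operatorname{dist}_Y(\operatorname{supp}u,Y\setminus U)>0$; $\|\varphi^*\vert U\|$ is the smallest $C\ge 0$ such that $\big(\int_X|\nabla_q(u\circ\varphi)|^q\,d\mu\big)^{1/q}\le C\big(\int_U|\nabla_p u|^p\,d\nu\big)^{1/p}$ for all $u\in D^{1,p}(U)\cap\overset{\circ}{\operatorname{Lip}}(U)$. *)

(* Defs.v *)
From HB Require Import structures.
From mathcomp Require Import all_boot all_order all_algebra.
From mathcomp Require Import all_classical all_reals all_analysis.
From mathcomp Require Import measurable_realfun.

Set Implicit Arguments.
Unset Strict Implicit.
Unset Printing Implicit Defensive.

Import Order.TTheory GRing.Theory Num.Theory.
Import numFieldNormedType.Exports.

Local Open Scope classical_set_scope.
Local Open Scope ring_scope.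
Local Open Scope ereal_scope.

(* Measurable types are pointed in the library. A metric measure space is not
   empty, since its measure is not zero, so asking for a point costs nothing. *)
#[short(type="pmetricType")]
HB.structure Definition PointedMetric (K : numDomainType) :=
  {M of Metric K M & isPointed M}.

Notation borel_type X := (g_sigma_algebraType (@open X)).

Section metric_notions.
Context {R : realType} {X : pmetricType R}.
Implicit Types (A B : set X) (u : X -> R).

Definition borel A : Prop := measurable (A : set (borel_type X)).

Definition borel_fun A (g : X -> \bar R) : Prop :=
  measurable_fun (A : set (borel_type X)) (g : borel_type X -> \bar R).

Definition metric_bounded A : Prop := exists x r, A `<=` ball x r.

Definition separable_space : Prop := exists2 D : set X, countable D & dense D.

Definition Lip u : Prop :=
  exists L : R, forall x y, (`|u x - u y| <= L * mdist x y)%R.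

Definition supp u : set X := closure [set x | u x != 0%R].

(* The infimum over the empty set is +oo, hence so is the distance between two
   sets one of which is empty. *)
Definition set_dist A B : \bar R :=
  ereal_inf [set (mdist x y)%:E | x in A & y in B].

(* These functions are defined and Lipschitz on all of X; only the position of
   their support depends on U. *)
Definition Lip0 (U : set X) u : Prop := Lip u /\ 0 < set_dist (supp u) (~` U).

End metric_notions.

Arguments separable_space {R} X.

Record metric_measure_space (R : realType) (X : pmetricType R)
    (mu : {outer_measure set X -> \bar R}) : Prop := MetricMeasureSpace {
  mms_separable : separable_space X ;
  mms_borel : forall B : set X, borel B -> mu.-caratheodory B ;
  mms_regular : forall A : set X,
    exists2 B : set X, borel B & A `<=` B /\ mu A = mu B ;
  mms_finite : forall A : set X, metric_bounded A -> mu A < +oo ;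
  mms_nontrivial : mu [set: X] != 0 }.

Section curves.
Context {R : realType} {X : pmetricType R}.

(* The values of cmap outside [cstart, cend] play no role. *)
Record curve : Type := Curve {
  cstart : R ;
  cend : R ;
  cmap :> R -> X ;
  curve_le : (cstart <= cend)%R ;
  curve_continuous : {within `[cstart, cend], continuous cmap} }.

Implicit Types (c : curve) (rho g : X -> \bar R).

Definition curve_in (E : set X) c : Prop :=
  forall t, t \in `[cstart c, cend c] -> E (c t).

Definition path_length (f : R -> X) (a b : R) : \bar R :=
  ereal_sup [set (\sum_(0 <= n < size s)
                    mdist (f (nth b (a :: s) n)) (f (nth b s n)))%R%:E
            | s in itv_partition a b].

Definition curve_length c : \bar R := path_length c (cstart c) (cend c).

Definition rectifiable c : Prop := curve_length c < +oo.

(* The arc length parametrization, on [0, length c], of a rectifiable curve: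
   arclength c s is the value of c at any time t at which the part of c on
   [cstart c, t] has length s; this value does not depend on t. *)
Definition arclength c (s : R) : X :=
  c (xget (cstart c) [set t | t \in `[cstart c, cend c] /\
                              path_length c (cstart c) t = s%:E]).

Definition line_integral c g : \bar R :=
  \int[lebesgue_measure]_(s in `[0%R, fine (curve_length c)])
    g (arclength c s).

End curves.

Arguments curve {R} X.

(* The notions below are relative to a set E, in practice an open set with the
   restricted metric and measure: functions matter on E only, and curves stay
   in E. The whole space is E = setT. *)
Section sobolev.
Context {R : realType} {X : pmetricType R}.
Variable mu : {outer_measure set X -> \bar R}.
Implicit Types (E : set X) (u : X -> R) (g h rho : X -> \bar R) (p : R).

Local Notation M := (caratheodory_type mu).

Definition mu_measurable_fun E u : Prop :=
  measurable_fun (E : set M) (u : M -> R).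

(* The integral of g ^ p over E. *)
Definition energy p E g : \bar R :=
  \int[(mu : set M -> \bar R)]_(x in (E : set M)) (g x `^ p).

Definition nonneg_borel E g : Prop :=
  borel_fun E g /\ forall x, E x -> 0 <= g x.

Definition modulus p E (Gamma : set (curve X)) : \bar R :=
  ereal_inf [set energy p E rho | rho in [set rho | nonneg_borel E rho /\
    forall c, Gamma c -> rectifiable c -> 1 <= line_integral c rho]].

Definition upper_gradient_along u g (c : curve X) : Prop :=
  `|u (c (cstart c)) - u (c (cend c))|%:E <= line_integral c g.

Definition upper_gradient E u g : Prop :=
  nonneg_borel E g /\
  forall c, rectifiable c -> curve_in E c -> upper_gradient_along u g c.

Definition weak_upper_gradient p E u g : Prop :=
  nonneg_borel E g /\
  modulus p E [set c | [/\ rectifiable c, curve_in E c &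
                           ~ upper_gradient_along u g c]] = 0.

Definition dirichlet p E u : Prop :=
  mu_measurable_fun E u /\
  exists2 g, upper_gradient E u g & energy p E g < +oo.

Definition locally_Lp p E g : Prop :=
  forall x, E x -> exists V : set X,
    [/\ open V, V x & energy p (E `&` V) g < +oo].

(* Local integrability makes the notion cover functions that are only locally
   Dirichlet. When u has a p-integrable weak upper gradient g, this is the usual
   minimal one, because min(g, h) is a p-integrable weak upper gradient for
   every weak upper gradient h. *)
Definition minimal_weak_upper_gradient p E u g : Prop :=
  [/\ weak_upper_gradient p E u g, locally_Lp p E g &
      forall h, weak_upper_gradient p E u h -> locally_Lp p E h ->
        {ae (mu : set M -> \bar R), forall x, E x -> g x <= h x}].

(* Unique up to null sets; the default value is never used for functions that
   are locally Dirichlet. *)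
Definition grad p E u : X -> \bar R :=
  xget (cst +oo) [set g | minimal_weak_upper_gradient p E u g].

Definition grad_norm p E u : \bar R := energy p E (grad p E u) `^ p^-1.

End sobolev.

Section composition.
Context {R : realType} {X Y : pmetricType R}.
Variables (mu : {outer_measure set X -> \bar R})
          (nu : {outer_measure set Y -> \bar R}).
Variables (p q : R) (phi : X -> Y).
Implicit Types (u v : Y -> R) (U B G : set Y).

Definition measurable_mapping : Prop :=
  measurable_fun [set: caratheodory_type mu]
    (phi : caratheodory_type mu -> borel_type Y).

Definition induces_bounded_composition : Prop :=
  (forall u, dirichlet nu p setT u -> Lip u -> dirichlet mu q setT (u \o phi)) /\
  exists C : R, forall u, dirichlet nu p setT u -> Lip u ->
    grad_norm mu q setT (u \o phi) <= C%:E * grad_norm nu p setT u.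

(* For Lipschitz u, the function u \o phi need not be locally Dirichlet, and
   phi^-1(G) need not be open: the gradient is the measurable function glued
   from those of the functions v \o phi. *)
Definition is_pullback_grad u (g : X -> \bar R) : Prop :=
  [/\ measurable_fun [set: caratheodory_type mu]
        (g : caratheodory_type mu -> \bar R),
      forall x, 0 <= g x &
      forall G v, open G -> metric_bounded G ->
        dirichlet nu p setT v -> Lip v -> (forall y, G y -> v y = u y) ->
        {ae (mu : set (caratheodory_type mu) -> \bar R), forall x,
           G (phi x) -> g x = grad mu q setT (v \o phi) x}].

Definition pullback_grad u : X -> \bar R := xget (cst +oo) (is_pullback_grad u).

Definition restricted_norm U : \bar R :=
  ereal_inf [set C%:E | C in [set C : R | (0 <= C)%R /\
    forall u, dirichlet nu p U u -> Lip0 U u ->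
      grad_norm mu q setT (u \o phi) <= C%:E * grad_norm nu p U u]].

Definition Phi (sigma : R) U : \bar R := restricted_norm U `^ sigma.

Definition Psi (sigma : R) B : \bar R :=
  ereal_sup [set energy mu q (phi @^-1` B) (pullback_grad u) `^ q^-1
            | u in [set u | Lip u /\ energy nu p B (grad nu p setT u) <= 1]]
  `^ sigma.

End composition.

(* Main.v *)
(* Minimal weak upper gradients are local: grad f1 = grad f2 almost everywhere on
   {f1 = +-f2 + c}. Indeed a weak upper gradient of w may be replaced by 0 on
   {w = 0}, since on a curve only the pieces before the first and after the last
   zero of w matter. For Phi <= Psi, a function supported in U extends by zero to
   Y with the same gradient, its composition with phi has zero gradient off
   phi^-1(U), and one rescales. For Psi <= Phi, a Lipschitz function u is replaced
   by f o u, where f is a sawtooth of slopes +-1 and small amplitude: by locality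
   this changes neither gradient, but f o u is so small that cutting it off near
   the complement of U costs little energy because nu(U) is finite. *)

Require Import Defs.
From HB Require Import structures.
From mathcomp Require Import all_boot all_order all_algebra.
From mathcomp Require Import all_classical all_reals all_analysis.
From mathcomp Require Import measurable_realfun.
From mathcomp Require Import lra.

Set Implicit Arguments.
Unset Strict Implicit.
Unset Printing Implicit Defensive.

Import Order.TTheory GRing.Theory Num.Theory.
Import numFieldNormedType.Exports.

Local Open Scope classical_set_scope.
Local Open Scope ring_scope.

(** * Length and arc length of curves *)

(** No derivative along a curve is ever taken. A weak upper gradient enters only through its
    inequality on almost every curve and on all subcurves of it, that is, through bounds |F s - F t|
    <= int_s^t g for the function read in arc length. Taking the minimum of two gradients and
    removing a gradient on a zero set thus become elementary statements about an interval. Closure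
    under minima also yields the minimal gradient without weak convergence: a minimizing family is
    replaced by its running minima, which decrease.

    The sawtooth is forced by the cutoff. Cutting off [u] itself near the complement of [U] costs
    about the size of [u] divided by the width d of the transition, which the energy of [u] does not
    control. For a function of size e the cost in the gradient is e / d, and e is chosen after d.

    A second obstacle is that [u \o phi] need not be Dirichlet for Lipschitz [u]. Locality is
    therefore applied to compositions of Dirichlet functions that equal [u] on balls. *)

Section path_length.
Context {R : realType} {X : pmetricType R}.
Implicit Types (f : R -> X) (a b s t : R) (l : seq R).

(** Recursive form of the sums in [path_length], which index by [nth]; it allows induction on the
    partition. *)
Fixpoint chain_length f a l : R :=
  if l is x :: l' then mdist (f a) (f x) + chain_length f x l' else 0.

Lemma chain_lengthE f a b l :
  \sum_(0 <= n < size l) mdist (f (nth b (a :: l) n)) (f (nth b l n)) =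
  chain_length f a l.
Proof.
elim: l a => [|x l IH] a; first by rewrite big_nil.
by rewrite /= big_nat_recl//= IH.
Qed.

Lemma chain_length_cat f a l1 l2 :
  chain_length f a (l1 ++ l2) = chain_length f a l1 + chain_length f (last a l1) l2.
Proof. by elim: l1 a => [|x l IH] a /=; rewrite ?add0r// IH addrA. Qed.

Lemma chain_length_le f a b l : itv_partition a b l ->
  ((chain_length f a l)%:E <= path_length f a b)%E.
Proof.
by move=> abl; apply: ereal_sup_ubound; exists l => //; rewrite (chain_lengthE f a b l).
Qed.

Lemma path_length_le f a b z :
  (forall l, itv_partition a b l -> ((chain_length f a l)%:E <= z)%E) ->
  (path_length f a b <= z)%E.
Proof.
by move=> h; apply: ge_ereal_sup => _ [l abl <-]; rewrite (chain_lengthE f a b l); apply: h.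
Qed.

Lemma mdist_path_length f a b : a <= b ->
  ((mdist (f a) (f b))%:E <= path_length f a b)%E.
Proof.
rewrite le_eqVlt => /predU1P[<-|ab].
  rewrite mdistxx; apply: (chain_length_le f (l := [::])); split => //=.
by have := chain_length_le f (itv_partition1 ab); rewrite /= addr0.
Qed.

Lemma path_length_ge0 f a b : a <= b -> (0 <= path_length f a b)%E.
Proof.
by move=> /(mdist_path_length f); apply: le_trans; rewrite lee_fin mdist_ge0.
Qed.

Lemma itv_partition_le_last a b l : itv_partition a b l -> a <= b.
Proof.
elim: l a => [|x l IH] a [/=]; first by move=> _ /eqP ->.
by move=> /andP[ax xl] lb; rewrite (le_trans (ltW ax))// IH.
Qed.

Lemma path_lengthxx f a : path_length f a a = 0%E.
Proof.
apply/eqP; rewrite eq_le path_length_ge0// andbT.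
apply: path_length_le => -[|x l] // [/= /andP[ax xl] la].
by have := itv_partition_le_last (conj xl la); rewrite leNgt ax.
Qed.

Lemma path_length_cat_ge f a b c : a <= b -> b <= c ->
  (path_length f a b + path_length f b c <= path_length f a c)%E.
Proof.
move=> ab bc.
have [->|fin] := eqVneq (path_length f a c) +oo%E; first by rewrite leey.
have H l1 l2 : itv_partition a b l1 -> itv_partition b c l2 ->
    ((chain_length f a l1)%:E + (chain_length f b l2)%:E <= path_length f a c)%E.
  move=> h1 h2; have := chain_length_le f (itv_partition_cat h1 h2).
  by rewrite chain_length_cat; case: h1 => _ /eqP ->.
have h l2 : itv_partition b c l2 ->
    (path_length f a b + (chain_length f b l2)%:E <= path_length f a c)%E.
  move=> h2; rewrite -leeBrDr//; apply: path_length_le => l1 h1.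
  by rewrite leeBrDr// H.
have abfin : path_length f a b \is a fin_num.
  have [l2 h2] : exists l2, itv_partition b c l2.
    move: bc; rewrite le_eqVlt => /predU1P[<-|bc]; first by exists [::].
    by exists [:: c]; exact: itv_partition1.
  rewrite ge0_fin_numE ?path_length_ge0//.
  rewrite ltey; apply: contra_neq fin => e; have := h _ h2.
  by rewrite e addye// leye_eq => /eqP.
rewrite addeC -leeBrDr//; apply: path_length_le => l2 h2.
by rewrite leeBrDr// addeC h.
Qed.

(** Induction along a partition of [[a, c]] up to the first point beyond b; there b is inserted,
    which by the triangle inequality does not decrease the sum. *)
Lemma path_length_cat_le f a b c : a <= b -> b <= c ->
  (path_length f a c <= path_length f a b + path_length f b c)%E.
Proof.
move=> ab bc; apply: path_length_le => l.
elim: l a ab => [|x l IH] a ab.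
  by move=> _; rewrite adde_ge0// path_length_ge0.
move=> [/= /andP[ax xl] la]; rewrite EFinD.
have [xb|bx] := leP x b.
  rewrite (le_trans (leeD2l _ (IH x xb (conj xl la))))// addeA leeD2r//.
  rewrite (le_trans _ (path_length_cat_ge f (ltW ax) xb))// leeD2r//.
  exact/mdist_path_length/ltW.
apply: (@le_trans _ _ ((mdist (f a) (f b))%:E + (mdist (f b) (f x) + chain_length f x l)%:E)%E).
  by rewrite -!EFinD lee_fin addrA lerD2r metric_triangle.
apply: leeD; first exact: mdist_path_length.
by apply: (chain_length_le f (l := x :: l)); split => //=; rewrite bx.
Qed.

Lemma path_lengthD f a b c : a <= b -> b <= c ->
  path_length f a c = (path_length f a b + path_length f b c)%E.
Proof.
by move=> ab bc; apply/eqP; rewrite eq_le path_length_cat_le//= path_length_cat_ge.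
Qed.

Lemma path_length_subset f a b s t : a <= s -> s <= t -> t <= b ->
  (path_length f s t <= path_length f a b)%E.
Proof.
move=> as_ st tb; rewrite (@path_lengthD f a s b)//; last exact: le_trans tb.
rewrite (@path_lengthD f s t b)// (le_trans (leeDl _ (path_length_ge0 f tb)))//.
by rewrite leeDr// path_length_ge0.
Qed.

Lemma within_itv_mdist f a b t (e : R) : {within `[a, b], continuous f} ->
  t \in `[a, b] -> 0 < e -> exists2 d, 0 < d &
  forall s, s \in `[a, b] -> `|t - s| < d -> mdist (f t) (f s) < e.
Proof.
move=> /subspace_continuousP cf tab e0.
have /nbhs_ballP[d /= d0 h] := cf t tab _ (nbhsx_ballx (f t) e e0).
exists d => // s sab ts; have := h s ts sab.
by rewrite /= ballEmdist.
Qed.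

(** Take a partition of [[t, b]] whose sum is within e / 2 of the length, and insert before its
    first point some s with [f s] within e / 2 of [f t]. The partition read from s bounds the length
    of [[s, b]] from below, which leaves at most e for [[t, s]]. *)
Lemma path_length_right_small f a b t (e : R) : {within `[a, b], continuous f} ->
  (path_length f a b < +oo)%E -> a <= t -> t < b -> 0 < e ->
  exists s, [/\ t < s, s <= b & (path_length f t s <= e%:E)%E].
Proof.
move=> cf fin at_ tb e0.
have e20 : 0 < e / 2 by rewrite divr_gt0.
have tbfin : path_length f t b \is a fin_num.
  rewrite ge0_fin_numE ?path_length_ge0// ?(ltW tb)//.
  by rewrite (le_lt_trans _ fin)// path_length_subset// ltW.
have [_ [l tl <-]] := ub_ereal_sup_adherent e20 tbfin.
rewrite (chain_lengthE f t b l) => le.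
case: l tl le => [|x l] [/=].
  by move=> _ /eqP tb'; move: tb; rewrite tb' ltxx.
move=> /andP[tx xl] la le.
have tab : t \in `[a, b] by rewrite in_itv/= at_ ltW.
have [d d0 h] := within_itv_mdist cf tab e20.
have xb : x <= b by exact: itv_partition_le_last (conj xl la).
pose s := Num.min (t + d / 2) ((t + x) / 2).
have ts : t < s by rewrite /s lt_min; apply/andP; split; lra.
have sx : s < x by rewrite /s gt_min; apply/orP; right; lra.
have sd : s <= t + d / 2 by rewrite /s ge_min lexx.
have sb : s <= b by lra.
exists s; split => //.
have dts : mdist (f t) (f s) < e / 2.
  apply: h; first by rewrite in_itv/=; apply/andP; split; lra.
  by rewrite distrC ger0_norm; lra.
have : ((chain_length f s (x :: l))%:E <= path_length f s b)%E.
  by apply: chain_length_le; split => //=; rewrite sx.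
move: le tbfin; rewrite -/(path_length f t b) (@path_lengthD f t s b)//; last exact: ltW.
have tsfin : path_length f t s \is a fin_num.
  rewrite ge0_fin_numE ?path_length_ge0// ?(ltW ts)//.
  by rewrite (le_lt_trans _ fin)// path_length_subset// ltW.
have sbfin : path_length f s b \is a fin_num.
  rewrite ge0_fin_numE ?path_length_ge0//.
  by rewrite (le_lt_trans _ fin)// path_length_subset//; lra.
rewrite -(fineK tsfin) -(fineK sbfin) -!EFinD lte_fin !lee_fin /=.
have := metric_triangle (f t) (f s) (f x); lra.
Qed.

Lemma path_length_left_small f a b t (e : R) : {within `[a, b], continuous f} ->
  (path_length f a b < +oo)%E -> a < t -> t <= b -> 0 < e ->
  exists s, [/\ a <= s, s < t & (path_length f s t <= e%:E)%E].
Proof.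
move=> cf fin at_ tb e0.
have e20 : 0 < e / 2 by rewrite divr_gt0.
have atfin : path_length f a t \is a fin_num.
  rewrite ge0_fin_numE ?path_length_ge0// ?(ltW at_)//.
  by rewrite (le_lt_trans _ fin)// path_length_subset// ltW.
have [_ [l tl <-]] := ub_ereal_sup_adherent e20 atfin.
rewrite (chain_lengthE f a t l) => le.
case/lastP: l tl le => [|l x] [/=].
  by move=> _ /eqP tb'; move: at_; rewrite tb' ltxx.
rewrite rcons_path last_rcons => /andP[al lx] /eqP xt; rewrite {x}xt in lx *.
rewrite -cats1 chain_length_cat/= addr0 => le.
set y := last a l in lx le.
have tab : t \in `[a, b] by rewrite in_itv/= tb ltW.
have [d d0 h] := within_itv_mdist cf tab e20.
have ay : a <= y by apply: (@itv_partition_le_last _ _ l); split.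
pose s := Num.max (t - d / 2) ((t + y) / 2).
have st : s < t by rewrite /s gt_max; apply/andP; split; lra.
have ys : y < s by rewrite /s lt_max; apply/orP; right; lra.
have sd : t - d / 2 <= s by rewrite /s le_max lexx.
exists s; split => //; first lra.
have dts : mdist (f t) (f s) < e / 2.
  apply: h; first by rewrite in_itv/=; apply/andP; split; lra.
  by rewrite ger0_norm; lra.
have : ((chain_length f a (rcons l s))%:E <= path_length f a s)%E.
  by apply: chain_length_le; split => //=; rewrite ?rcons_path ?al// last_rcons.
rewrite -cats1 chain_length_cat/= addr0 -/y.
move: le atfin; rewrite -/(path_length f a t) (@path_lengthD f a s t)//; [|lra|lra].
have asfin : path_length f a s \is a fin_num.
  rewrite ge0_fin_numE ?path_length_ge0//; last lra.
  by rewrite (le_lt_trans _ fin)// path_length_subset//; lra.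
have stfin : path_length f s t \is a fin_num.
  rewrite ge0_fin_numE ?path_length_ge0//; last lra.
  by rewrite (le_lt_trans _ fin)// path_length_subset//; lra.
rewrite -(fineK asfin) -(fineK stfin) -!EFinD lte_fin !lee_fin /=.
have := metric_triangle (f y) (f s) (f t); rewrite (metric_sym (f s) (f t)).
by lra.
Qed.

(** Intermediate value theorem for the length. At the supremum of the times of length at most s, a
    value below s contradicts continuity from the right and a value above s continuity from the
    left. *)
Lemma path_length_surj f a b (s : R) : {within `[a, b], continuous f} ->
  a <= b -> (path_length f a b < +oo)%E -> 0 <= s ->
  (s%:E <= path_length f a b)%E ->
  exists2 t, t \in `[a, b] & path_length f a t = s%:E.
Proof.
move=> cf ab fin s0 sL.
pose T := [set t | t \in `[a, b] /\ (path_length f a t <= s%:E)%E].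
have Ta : T a by split; [rewrite in_itv/= lexx|rewrite path_lengthxx lee_fin].
have Tb : ubound T b by move=> t [/itvP tab _]; rewrite tab.
have supT : has_sup T by split; [exists a|exists b].
have a_sup : a <= sup T by exact: ub_le_sup supT.2 _ Ta.
have sup_b : sup T <= b by apply: ge_sup => //; exists a.
exists (sup T); first by rewrite in_itv/= a_sup.
have finV t : a <= t -> t <= b -> path_length f a t \is a fin_num.
  move=> at_ tb; rewrite ge0_fin_numE ?path_length_ge0//.
  by rewrite (le_lt_trans _ fin)// path_length_subset.
have [lt|lt|//] := ltgtP (path_length f a (sup T)) s%:E.
- have sb : sup T < b.
    rewrite lt_neqAle sup_b andbT; apply: contraTN lt => /eqP ->.
    by rewrite -leNgt.
  have fs := finV _ a_sup sup_b.
  have e0 : 0 < s - fine (path_length f a (sup T)).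
    by rewrite subr_gt0 -lte_fin fineK.
  have [t [st tb le]] := path_length_right_small cf fin a_sup sb e0.
  have : T t.
    split; first by rewrite in_itv/= tb (le_trans a_sup)// ltW.
    rewrite (@path_lengthD f a (sup T) t)// ?(ltW st)//.
    by move: le; rewrite -(fineK fs) EFinB leeBrDr// addeC.
  by move=> /(ub_le_sup supT.2); rewrite leNgt st.
- have as_ : a < sup T.
    rewrite lt_neqAle a_sup andbT; apply: contraTN lt => /eqP <-.
    by rewrite path_lengthxx -leNgt lee_fin.
  have fs := finV _ a_sup sup_b.
  have e0 : 0 < fine (path_length f a (sup T)) - s.
    by rewrite subr_gt0 -lte_fin fineK.
  have e20 : 0 < (fine (path_length f a (sup T)) - s) / 2 by rewrite divr_gt0.
  have [t [at_ ts le]] := path_length_left_small cf fin as_ sup_b e20.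
  have /sup_adherent/(_ supT)[r [rab rs]] : 0 < sup T - t by rewrite subr_gt0.
  rewrite opprB addrC subrK => tr.
  have rsup : r <= sup T by apply: ub_le_sup => //; exact: supT.2.
  have : (path_length f a t <= s%:E)%E.
    by rewrite (le_trans _ rs)// path_length_subset// ltW.
  move: le fs e0; rewrite (@path_lengthD f a t (sup T))//; last exact: ltW.
  have ft : path_length f a t \is a fin_num by apply: finV => //; lra.
  have f2 : path_length f t (sup T) \is a fin_num.
    rewrite ge0_fin_numE ?path_length_ge0//; last exact: ltW.
    by rewrite (le_lt_trans _ fin)// path_length_subset// ltW.
  rewrite -(fineK ft) -(fineK f2) -EFinD !lee_fin/=.
  by move=> h1 _ h2 h3; exfalso; lra.
Qed.

End path_length.

Section arclength.
Context {R : realType} {X : pmetricType R}.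
Variable c : curve X.
Hypothesis rc : rectifiable c.
Local Notation a := (cstart c).
Local Notation b := (cend c).
Local Notation L := (fine (curve_length c)).

Let ab : a <= b := curve_le c.
Let cc : {within `[a, b], continuous c} := @curve_continuous _ _ c.

Lemma curve_length_fin : curve_length c \is a fin_num.
Proof. by rewrite ge0_fin_numE// path_length_ge0. Qed.

Lemma curve_length_ge0 : 0 <= L.
Proof. by rewrite fine_ge0// path_length_ge0. Qed.

Lemma path_length_fin s t : a <= s -> s <= t -> t <= b ->
  path_length c s t \is a fin_num.
Proof.
move=> as_ st tb; rewrite ge0_fin_numE ?path_length_ge0//.
by rewrite (le_lt_trans _ rc)// path_length_subset.
Qed.

Lemma arclength_param s : 0 <= s <= L -> exists2 t, t \in `[a, b] &
  path_length c a t = s%:E.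
Proof.
move=> /andP[s0 sL]; apply: path_length_surj => //.
by move: sL; rewrite -lee_fin (fineK curve_length_fin).
Qed.

(** Two times with the same length bound an arc of length zero, so [c] has the same value at both
    and the choice made by [xget] is immaterial. *)
Lemma arclengthE s t : t \in `[a, b] -> path_length c a t = s%:E ->
  arclength c s = c t.
Proof.
move=> tab ts; rewrite /arclength; case: xgetP => [r _ [rab rs]|/(_ t)].
  have key u v : u \in `[a, b] -> v \in `[a, b] -> u <= v ->
      path_length c a u = s%:E -> path_length c a v = s%:E -> c u = c v.
    move=> /itvP uab /itvP vab uv us.
    rewrite (@path_lengthD _ _ c a u v) ?uab// us => vs.
    have uvfin : path_length c u v \is a fin_num.
      by apply: path_length_fin; rewrite ?uab ?vab.
    apply: mdist_positivity; apply/eqP; rewrite eq_le mdist_ge0 andbT.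
    rewrite -lee_fin (le_trans (mdist_path_length c uv))//.
    by move: vs; rewrite -(fineK uvfin) -EFinD => -[] /(canRL (addKr _)) ->; rewrite addNr.
  by have [tr|rt] := leP t r; [apply/esym/key|apply: key => //; exact: ltW].
by case.
Qed.

Lemma arclength_Lip s t : 0 <= s -> s <= t -> t <= L ->
  mdist (arclength c s) (arclength c t) <= t - s.
Proof.
move=> s0 st tL.
have [u uab us] : exists2 u, u \in `[a, b] & path_length c a u = s%:E.
  by apply: arclength_param; rewrite s0 (le_trans st).
have [v vab vt] : exists2 u, u \in `[a, b] & path_length c a u = t%:E.
  by apply: arclength_param; rewrite tL (le_trans s0).
rewrite (arclengthE uab us) (arclengthE vab vt).
have [uv|vu] := leP u v.
  rewrite -lee_fin (le_trans (mdist_path_length c uv))//.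
  move: vt; rewrite (@path_lengthD _ _ c a u v) ?(itvP uab)// us => h.
  have uvfin : path_length c u v \is a fin_num.
    by apply: path_length_fin; rewrite ?(itvP uab) ?(itvP vab).
  by move: h; rewrite -(fineK uvfin) -EFinD => -[<-]; rewrite addrC addKr.
rewrite metric_sym -lee_fin (le_trans (mdist_path_length c (ltW vu)))//.
move: us; rewrite (@path_lengthD _ _ c a v u) ?(itvP vab)// ?(ltW vu)// vt => h.
have uvfin : path_length c v u \is a fin_num.
  by apply: path_length_fin; rewrite ?(itvP uab) ?(itvP vab) ?(ltW vu).
move: h; rewrite -(fineK uvfin) -EFinD => -[h].
by rewrite lee_fin; lra.
Qed.

(* Constant outside [0, length c], so that it is continuous on the whole line. *)
Definition arcline (s : R) : X := arclength c (Num.max 0 (Num.min s L)).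

Lemma arclineE s : 0 <= s <= L -> arcline s = arclength c s.
Proof.
by move=> /andP[s0 sL]; rewrite /arcline (min_idPl sL) (max_idPr s0).
Qed.

Lemma arcline_param s : exists2 t, t \in `[a, b] & arcline s = c t.
Proof.
have [t tab ts] : exists2 t, t \in `[a, b] &
    path_length c a t = (Num.max 0 (Num.min s L))%:E.
  apply: arclength_param; rewrite le_max lexx/= ge_max curve_length_ge0/=.
  by rewrite ge_min lexx orbT.
by exists t => //; rewrite /arcline (arclengthE tab).
Qed.

Lemma arcline_in (E : set X) s : curve_in E c -> E (arcline s).
Proof. by move=> cE; have [t tab ->] := arcline_param s; exact: cE. Qed.

Lemma arcline0 : arcline 0 = c a.
Proof.
rewrite arclineE ?lexx ?curve_length_ge0//.
by apply: arclengthE; rewrite ?path_lengthxx// in_itv/= lexx.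
Qed.

Lemma arclineL : arcline L = c b.
Proof.
rewrite arclineE ?lexx ?curve_length_ge0//.
by apply: arclengthE; rewrite ?fineK ?curve_length_fin// in_itv/= lexx andbT.
Qed.

Lemma arcline_Lip s t : mdist (arcline s) (arcline t) <= `|s - t|.
Proof.
wlog st : s t / s <= t.
  move=> h; have [/h//|/ltW/h] := leP s t.
  by rewrite metric_sym distrC.
rewrite ler0_norm ?subr_le0// opprB.
have L0 := curve_length_ge0.
apply: le_trans (arclength_Lip _ _ _) _.
- by rewrite le_max lexx.
- rewrite /Num.max /Num.min.
  by case: ifPn; case: ifPn; case: ifPn; case: ifPn; lra.
- by rewrite ge_max L0 ge_min lexx orbT.
rewrite /Num.max /Num.min.
by case: ifPn; case: ifPn; case: ifPn; case: ifPn; lra.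
Qed.

Lemma arcline_continuous : continuous arcline.
Proof.
move=> s A /nbhs_ballP[e /= e0 eA]; apply/nbhs_ballP; exists e => //= t st.
by apply: eA; rewrite ballEmdist/=; exact: le_lt_trans (arcline_Lip _ _) st.
Qed.

Lemma subcurve_subproof s t : a <= s -> t <= b ->
  {within `[s, t], continuous c}.
Proof.
move=> as_ tb; apply: continuous_subspaceW cc => x /=.
by rewrite !in_itv/= => /andP[sx xt]; rewrite (le_trans as_)// (le_trans xt).
Qed.

Lemma line_integralE (g : X -> \bar R) :
  line_integral c g =
  (\int[lebesgue_measure]_(r in `[0%R, L]) g (arcline r))%E.
Proof.
apply: eq_integral => r; rewrite inE/= in_itv/= => rL.
by rewrite arclineE.
Qed.

End arclength.

(** Translation invariance from the uniqueness of Lebesgue measure: the pushforward under a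
    translation has the same values on half-open intervals. *)
Lemma ge0_integral_shift (R : realType) (f : R -> \bar R) (a l : R) :
  measurable_fun setT f -> (forall x, 0 <= f x)%E ->
  (\int[lebesgue_measure]_(x in `[0%R, l]) f (a + x)%R =
   \int[lebesgue_measure]_(x in `[a, (a + l)%R]) f x)%E.
Proof.
move=> mf f0.
have mphi : measurable_fun setT ((fun x : R => a + x) : measurableTypeR R -> measurableTypeR R).
  by apply: measurable_funD.
have pre y z : ((fun x : R => a + x) : measurableTypeR R -> measurableTypeR R) @^-1` [set` Interval (BSide y a) (BSide z (a + l))] =
    [set` Interval (BSide y 0) (BSide z l)].
  by apply/seteqP; case: y; case: z; split => x /=; rewrite !in_itv/= => /andP[? ?]; apply/andP; split; lra.
rewrite -(pre true false) -[LHS](@ge0_integral_pushforward _ _ (measurableTypeR R) (measurableTypeR R) R _ mphi lebesgue_measure)//=; last first.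
  exact: measurable_funS mf.
apply: eq_measure_integral => //= A mA _; apply/esym.
apply: lebesgue_measure_unique => // _ [[y z] _ <-] /=.
rewrite /pushforward.
have -> : (fun x : R => a + x) @^-1` `]y, z] = `](y - a), (z - a)]%classic.
  by apply/seteqP; split => x /=; rewrite !in_itv/= => /andP[? ?]; apply/andP; split; lra.
rewrite !lebesgue_measure_itv/= !lte_fin ltrD2r.
by case: ifP => // _; rewrite -!EFinB; congr EFin; lra.
Qed.

Section subcurve.
Context {R : realType} {X : pmetricType R}.
Local Open Scope ereal_scope.

(** Restrict [c] to times at which its length is s and t. The arc length of the restriction is that
    of [c] shifted by s. This lemma transfers properties of almost every curve to subcurves. *)
Lemma exists_subcurve (c : curve X) (s t : R) : rectifiable c ->
  (0 <= s)%R -> (s <= t)%R -> (t <= fine (curve_length c))%R ->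
  exists c' : curve X,
  [/\ rectifiable c', c' (cstart c') = arcline c s, c' (cend c') = arcline c t,
      forall r, r \in `[cstart c', cend c'] ->
        exists2 z, (s <= z <= t)%R & c' r = arcline c z &
      forall g : X -> \bar R,
        measurable_fun setT (g \o arcline c : R -> \bar R) ->
        (forall r, 0 <= g (arcline c r)) ->
        line_integral c' g =
        \int[lebesgue_measure]_(r in `[s, t]) g (arcline c r)].
Proof.
move=> rc s0 st tL.
have [u uab us] : exists2 u, u \in `[cstart c, cend c] & path_length c (cstart c) u = s%:E.
  by apply: arclength_param => //; rewrite s0 (le_trans st).
have [v vab [vt uv]] : exists2 u', u' \in `[cstart c, cend c] &
    path_length c (cstart c) u' = t%:E /\ (u <= u')%R.
  have [v vab vt] : exists2 u, u \in `[cstart c, cend c] & path_length c (cstart c) u = t%:E.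
    by apply: arclength_param => //; rewrite tL (le_trans s0).
  have [uv|vu] := leP u v; first by exists v.
  (* If the chosen times come in the wrong order, monotonicity of the length forces s = t, and the
     first time serves for both. *)
  exists u => //; split => //.
  have : path_length c (cstart c) v <= path_length c (cstart c) u.
    by apply: path_length_subset; rewrite ?(itvP vab)// ltW.
  by rewrite us vt lee_fin => ts; congr EFin; apply/eqP; rewrite eq_le st ts.
have au : (cstart c <= u)%R by rewrite (itvP uab).
have vb : (v <= cend c)%R by rewrite (itvP vab).
have uvfin := path_length_fin rc au uv vb.
have uvL : path_length c u v = (t - s)%:E.
  move: vt; rewrite (@path_lengthD _ _ c (cstart c) u v)// us -(fineK uvfin) -EFinD => -[<-].
  by rewrite addrC addKr.
pose c' := Curve uv (subcurve_subproof au vb).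
have rc' : rectifiable c' by rewrite /rectifiable /curve_length/= uvL ltry.
have Lc' : fine (curve_length c') = (t - s)%R by rewrite /curve_length/= uvL.
have val w z : (u <= w)%R -> (w <= v)%R -> path_length c u w = z%:E ->
    c w = arcline c (s + z)%R.
  move=> uw wv wz.
  have aw : path_length c (cstart c) w = (s + z)%:E.
    by rewrite (@path_lengthD _ _ c (cstart c) u w)// us wz.
  have wab : w \in `[cstart c, cend c].
    by rewrite in_itv/= (le_trans au)//= (le_trans wv).
  rewrite arclineE; first by rewrite (arclengthE rc wab aw).
  rewrite -lee_fin -aw path_length_ge0//=; last by rewrite (itvP wab).
  rewrite -lee_fin -aw fineK ?curve_length_fin//.
  by rewrite path_length_subset ?(itvP wab).
exists c'; split => //=.
- by rewrite (val u 0%R)// ?addr0// path_lengthxx.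
- by rewrite (val v (t - s)%R)// addrC subrK.
- move=> r /itvP rI; have rfin : path_length c u r \is a fin_num.
    by apply: (path_length_fin rc au); rewrite ?rI// (le_trans _ vb)// rI.
  exists (s + fine (path_length c u r))%R; last first.
    by apply: val; rewrite ?rI// fineK.
  rewrite lerDl fine_ge0 ?path_length_ge0 ?rI//=.
  rewrite -lerBrDl -lee_fin fineK// -uvL path_length_subset// ?rI//.
- move=> g mg g0; rewrite /line_integral Lc'.
  have -> : \int[lebesgue_measure]_(r in `[s, t]) g (arcline c r) =
      \int[lebesgue_measure]_(r in `[s, (s + (t - s))%R]) (g \o arcline c) r.
    by rewrite addrC subrK.
  rewrite -ge0_integral_shift//.
  apply: eq_integral => r; rewrite inE/= in_itv/= => rI; congr g.
  have [w /itvP wuv wr] := @arclength_param _ _ c' rc' r (eq_ind_r (fun z => is_true (0 <= r <= z)%R) rI Lc').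
  have wI : w \in `[cstart c', cend c'] by rewrite in_itv/= !wuv.
  by rewrite -(val w r) ?wuv//; exact: (arclengthE rc' wI wr).
Qed.

End subcurve.

(** * Functions with integrable increments on an interval *)

Section interval_integrals.
Context {R : realType}.
Local Open Scope ereal_scope.
Implicit Types (g h : R -> \bar R) (F : R -> R).
Local Notation mu := lebesgue_measure.

Lemma ge0_integral_itv_split g (s t r : R) : measurable_fun setT g ->
  (forall x, 0 <= g x) -> (s <= t)%R -> (t <= r)%R ->
  \int[mu]_(x in `[s, r]) g x =
  \int[mu]_(x in `[s, t]) g x + \int[mu]_(x in `[t, r]) g x.
Proof.
move=> mg g0 st tr.
rewrite -[X in _ = X + _](@integral_itv_bndo_bndc _ (BLeft s) t); last first.
  exact: measurable_funTS.
rewrite -ge0_integral_setU//=.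
- by rewrite -itv_bndbnd_setU.
- exact: measurable_funTS.
- apply/disj_setPLR => x /=; rewrite !in_itv/= => /andP[_ xt].
  by apply/negP; rewrite negb_and -ltNge xt.
Qed.

(** Being integrable, [g] is finite almost everywhere on [[a, b]]; passing to the real function
    [fine \o h] therefore keeps the integrals over subsets of [[a, b]]. *)
Lemma ge0_integral_abs_continuous g (a b e : R) : measurable_fun setT g ->
  (forall x, 0 <= g x) -> \int[mu]_(x in `[a, b]) g x < +oo -> (0 < e)%R ->
  exists2 d : R, (0 < d)%R & forall A, measurable A -> A `<=` `[a, b] ->
    mu A < d%:E -> \int[mu]_(x in A) g x < e%:E.
Proof.
move=> mg g0 goo e0.
pose h := g \_ `[a, b].
have mh : measurable_fun setT h.
  by apply/(measurable_restrictT _ _).1 => //; exact: measurable_funTS.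
have h0 x : 0 <= h x by exact: erestrict_ge0.
have hoo : mu.-integrable setT h.
  apply/integrableP; split => //.
  by under eq_integral do rewrite gee0_abs//; rewrite -integral_mkcond.
have le x : `|(fine (h x))%:E| <= `|h x|.
  by move: (h0 x); case: (h x) => [r _|_|]//=; rewrite normr0 leey.
have fhoo : mu.-integrable setT (EFin \o (fine \o h)).
  apply: le_integrable hoo => //; last by move=> x _; exact: le.
  by apply/measurable_EFinP; exact: measurableT_comp.
have [d [d0 hd]] := integral_normr_continuous fhoo e0.
exists d => // A mA Aab /(hd _ mA).
rewrite /Rintegral -lte_fin fineK; last first.
  apply: integrable_fin_num => //; apply: integrable_norm => //.
  by apply: integrableS fhoo.
apply: le_lt_trans.
rewrite le_eqVlt; apply/orP; left; apply/eqP; apply: ge0_ae_eq_integral => //.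
- exact: measurable_funTS.
- apply: measurable_funTS; apply/measurable_EFinP.
  apply: measurableT_comp => //; exact: measurableT_comp.
have [N [mN N0 hN]] := integrable_ae measurableT hoo.
exists N; split => // x /= /not_implyP[Ax gx]; apply: hN => /= /(_ I) fx; apply: gx.
rewrite /= ger0_norm ?fine_ge0// fineK//.
by rewrite /h patchE mem_set//; exact: Aab.
Qed.

(** Compactness as real induction: the supremum of the times reached from a is itself reached, and
    its neighbourhood leads further unless it is b. No finite subdivision has to be constructed. *)
Lemma interval_chain (Q : R -> R -> Prop) (a b : R) : (a <= b)%R ->
  (forall s t r, (a <= s)%R -> (s <= t)%R -> (t <= r)%R -> (r <= b)%R ->
     Q s t -> Q t r -> Q s r) ->
  (forall x, (a <= x <= b)%R -> exists2 d : R, (0 < d)%R &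
     forall s t, (a <= s)%R -> (s <= t)%R -> (t <= b)%R ->
     (`|s - x| < d)%R -> (`|t - x| < d)%R -> Q s t) ->
  Q a b.
Proof.
move=> ab trQ locQ.
pose T := [set t | (a <= t <= b)%R /\ Q a t].
have Ta : T a.
  split; first by rewrite lexx.
  have [|d d0 h] := locQ a; first by rewrite lexx.
  by apply: h => //; rewrite subrr normr0.
have Tb : ubound T b by move=> t [/andP[_ tb] _].
have supT : has_sup T by split; [exists a|exists b].
have a_sup : (a <= sup T)%R by exact: ub_le_sup supT.2 _ Ta.
have sup_b : (sup T <= b)%R by apply: ge_sup => //; exists a.
have [|d d0 h] := locQ (sup T); first by rewrite a_sup.
have [r [/andP[ar rb] Qr] lr] := sup_adherent d0 supT.
have rs : (r <= sup T)%R.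
  by apply: ub_le_sup; [exact: supT.2|split => //; rewrite ar].
pose w := Num.min b (sup T + d / 2)%R.
have wb : (w <= b)%R by rewrite /w ge_min lexx.
have wd : (w <= sup T + d / 2)%R by rewrite /w ge_min lexx orbT.
have sw : (sup T <= w)%R by rewrite /w le_min sup_b; lra.
have Qaw : Q a w.
  apply: (trQ _ r) => //; first lra.
  by apply: h => //; [lra|rewrite ltr_norml; apply/andP; split; lra..].
have : (w <= sup T)%R.
  by apply: ub_le_sup; [exact: supT.2|split => //; apply/andP; split; lra].
move: Qaw wb sw; rewrite /w /Num.min; case: ifPn => // _ _ _ _; lra.
Qed.

End interval_integrals.

Section interval_inequalities.
Context {R : realType}.
Local Open Scope ereal_scope.
Implicit Types (g h : R -> \bar R) (F : R -> R).
Local Notation mu := lebesgue_measure.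

(** With [u \o arcline c] and [g \o arcline c] for the two functions, this is the upper gradient
    inequality on all subcurves of [c]. *)
Definition increments_bounded F g (L : R) : Prop :=
  forall s t : R, (0 <= s)%R -> (s <= t)%R -> (t <= L)%R ->
  `|F s - F t|%:E <= \int[mu]_(x in `[s, t]) g x.

(* By inner regularity all but a set N of small measure is covered by two
   disjoint compact sets, on which g <= h and h < g respectively. Every point
   has a neighbourhood missing one of them, so on short intervals one of the
   two hypotheses bounds the increments of F by the integral of min(g, h), up
   to the integral of g + h over N. *)
Lemma increments_bounded_min F g h (L : R) : (0 <= L)%R ->
  measurable_fun setT g -> (forall x, 0 <= g x) ->
  measurable_fun setT h -> (forall x, 0 <= h x) ->
  increments_bounded F g L -> increments_bounded F h L ->
  \int[mu]_(x in `[0%R, L]) g x < +oo -> \int[mu]_(x in `[0%R, L]) h x < +oo ->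
  `|F 0%R - F L|%:E <= \int[mu]_(x in `[0%R, L]) mine (g x) (h x).
Proof.
move=> L0 mg g0 mh h0 Fg Fh goo hoo; apply/lee_addgt0Pr => e e0.
pose I := `[0%R, L]%classic.
have mI : measurable (I : set (measurableTypeR R)) by exact: measurable_itv.
have mgh : measurable_fun setT (fun x => g x + h x) by exact: emeasurable_funD.
have gh0 x : 0 <= g x + h x by rewrite adde_ge0.
have ghoo : \int[mu]_(x in I) (g x + h x) < +oo.
  rewrite ge0_integralD//; [|exact: measurable_funTS..].
  by rewrite lte_add_pinfty.
have [d d0 hd] := ge0_integral_abs_continuous mgh gh0 ghoo e0.
pose A := I `&` [set x | g x <= h x].
pose B := I `\` A.
have mA : measurable A by apply: measurable_lee => //; exact: measurable_funTS.
have mB : measurable B by apply: measurableD.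
have finI D : measurable D -> D `<=` I -> mu D < +oo.
  move=> mD DI; apply: (@le_lt_trans _ _ (mu I)).
    by apply: le_measure => //; rewrite inE.
  by rewrite lebesgue_measure_itv/=; case: ifP => _; rewrite ltry.
have d20 : (0 < d / 2)%R by rewrite divr_gt0.
have AI : A `<=` I by move=> x [].
have BI : B `<=` I by move=> x [].
have [K [cK KA hK]] := lebesgue_regularity_inner mA (finI _ mA AI) d20.
have [K' [cK' KB hK']] := lebesgue_regularity_inner mB (finI _ mB BI) d20.
have mK := compact_measurable cK; have mK' := compact_measurable cK'.
pose N := (A `\` K) `|` (B `\` K').
have mN : measurable N by apply: measurableU; exact: measurableD.
have NI : N `<=` I by move=> x [[/AI]|[/BI]].
have Nd : mu N < d%:E.
  apply: (@le_lt_trans _ _ (mu (A `\` K) + mu (B `\` K'))).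
    by apply: measureU2; exact: measurableD.
  by rewrite (splitr d) EFinD lteD.
pose k x := mine (g x) (h x) + ((fun x => g x + h x) \_ N) x.
have mm : measurable_fun setT (fun x => mine (g x) (h x)) by exact: measurable_mine.
have m0 x : 0 <= mine (g x) (h x) by rewrite le_min g0 h0.
have mr : measurable_fun setT ((fun x => g x + h x) \_ N).
  by apply/(measurable_restrictT _ _).1 => //; exact: measurable_funTS.
have r0 x : 0 <= ((fun x => g x + h x) \_ N) x by apply: erestrict_ge0.
have mk : measurable_fun setT k by exact: emeasurable_funD.
have k0 x : 0 <= k x by rewrite adde_ge0.
have kN x : N x -> g x <= k x /\ h x <= k x.
  move=> Nx; rewrite /k patchE mem_set//.
  by split; rewrite (le_trans _ (leeDr _ (m0 x)))// ?leeDl ?leeDr.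
have kg x : I x -> ~ K' x -> g x <= k x.
  move=> Ix K'x; have [Ax|nAx] := pselect (A x).
    by rewrite /k (min_idPl _) ?leeDl//; case: Ax.
  by apply: (kN _ _).1; right; do !split.
have kh x : I x -> ~ K x -> h x <= k x.
  move=> Ix Kx; have [Ax|nAx] := pselect (A x).
    by apply: (kN _ _).2; left; split.
  rewrite /k (min_idPr _) ?leeDl//.
  by rewrite leNgt; apply/negP => hg; apply: nAx; split => //=; exact: ltW.
have : `|F 0%R - F L|%:E <= \int[mu]_(x in I) k x.
  apply: (@interval_chain _ (fun s t => `|F s - F t|%:E <= \int[mu]_(x in `[s, t]) k x) 0%R L) => //.
    move=> s t r s0 st tr rL Qst Qtr; rewrite (ge0_integral_itv_split mk k0 st tr).
    by rewrite (le_trans _ (leeD Qst Qtr))// -EFinD lee_fin ler_distD.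
  have away (C : set R) x : compact C -> ~ C x -> exists2 d : R, (0 < d)%R &
      forall y, (`|y - x| < d)%R -> ~ C y.
    move=> cC nCx; have := compact_closed (@Rhausdorff R) cC.
    move=> /closed_openC; rewrite openE => /(_ x nCx) /nbhs_ballP[d' /= d'0 hd'].
    by exists d' => // y yx; apply: hd'; rewrite /ball/= distrC.
  have near s t x (r : R) (d' : R) : (`|s - x| < d')%R -> (`|t - x| < d')%R ->
      r \in `[s, t] -> (`|r - x| < d')%R.
    move=> sx tx; rewrite in_itv/= => /andP[sr rt].
    move: sx tx; rewrite !ltr_norml => /andP[? ?] /andP[? ?].
    by apply/andP; split; lra.
  have inI s t r : (0 <= s)%R -> (t <= L)%R -> r \in `[s, t] -> I r.
    by move=> s0 tL /itvP rst; rewrite /I/= in_itv/= (le_trans s0) ?rst// (le_trans _ tL)// rst.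
  move=> x xI; have [Kx|Kx] := pselect (K x).
    have K'x : ~ K' x by move=> /KB[_]; apply; exact: KA.
    have [d' d'0 hd'] := away _ _ cK' K'x; exists d' => // s t s0 st tL sx tx.
    rewrite (le_trans (Fg s t s0 st tL))//; apply: ge0_le_integral => //.
    - exact: measurable_funTS.
    - exact: measurable_funTS.
    - move=> r rst; apply: kg; first exact: inI rst.
      by apply: hd'; exact: near rst.
  have [d' d'0 hd'] := away _ _ cK Kx; exists d' => // s t s0 st tL sx tx.
  rewrite (le_trans (Fh s t s0 st tL))//; apply: ge0_le_integral => //.
  - exact: measurable_funTS.
  - exact: measurable_funTS.
  - move=> r rst; apply: kh; first exact: inI rst.
    by apply: hd'; exact: near rst.
move=> /le_trans; apply.
rewrite /k ge0_integralD//; [|exact: measurable_funTS..].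
rewrite leeD2l//= -integral_mkcondr setIidr//.
exact/ltW/hd.
Qed.

(** Absolute continuity of the integral of [g]. The clamping hypothesis says that [F] is constant on
    either side of [[0, L]], as functions read along [arcline] are, so that continuity holds on the
    whole line. *)
Lemma increments_continuous F g (L : R) : (0 <= L)%R ->
  measurable_fun setT g -> (forall x, 0 <= g x) ->
  (forall s, F s = F (Num.max 0 (Num.min s L))%R) ->
  increments_bounded F g L -> \int[mu]_(x in `[0%R, L]) g x < +oo ->
  continuous F.
Proof.
move=> L0 mg g0 Fc Fg goo s A /nbhs_ballP[e /= e0 eA].
have [d d0 hd] := ge0_integral_abs_continuous mg g0 goo e0.
apply/nbhs_ballP; exists d => //= t st; apply: eA.
rewrite /ball/= (Fc s) (Fc t) -lte_fin.
have key x y : (0 <= x)%R -> (x <= y)%R -> (y <= L)%R -> (y - x < d)%R ->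
    `|F x - F y|%:E < e%:E.
  move=> x0 xy yL yxd; apply: le_lt_trans (Fg _ _ x0 xy yL) _.
  apply: hd => //.
    by move=> z; rewrite /= !in_itv/= => /andP[xz zy]; rewrite (le_trans x0)// (le_trans zy).
  rewrite lebesgue_measure_itv/= lte_fin; case: ifPn => //.
have clamp0 x : (0 <= Num.max 0 (Num.min x L))%R by rewrite le_max lexx.
have clampL x : (Num.max 0 (Num.min x L) <= L)%R by rewrite ge_max L0 ge_min lexx orbT.
have cl x y : (x <= y)%R -> (Num.max 0 (Num.min x L) <= Num.max 0 (Num.min y L))%R /\
    (Num.max 0 (Num.min y L) - Num.max 0 (Num.min x L) <= y - x)%R.
  move=> xy; rewrite /Num.max /Num.min.
  by case: ifPn; case: ifPn; case: ifPn; case: ifPn; split; lra.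
have [stl|/ltW tsl] := leP s t.
  have [h1 h2] := cl _ _ stl; apply: key => //.
  by move: st; rewrite /ball/= distrC ger0_norm ?subr_ge0//; lra.
have [h1 h2] := cl _ _ tsl; rewrite distrC; apply: key => //.
by move: st; rewrite /ball/= ger0_norm ?subr_ge0//; lra.
Qed.

Lemma first_zero F (L : R) : continuous F ->
  (exists2 z, (0 <= z <= L)%R & F z = 0%R) ->
  exists z, [/\ (0 <= z <= L)%R, F z = 0%R &
                forall r, (0 <= r)%R -> (r < z)%R -> F r <> 0%R].
Proof.
move=> cF [z zL Fz].
pose Z := [set z | (0 <= z <= L)%R /\ F z = 0%R].
have Zz : Z z by [].
have Z0 : lbound Z 0%R by move=> t [/andP[]].
have infZ : has_inf Z by split; [exists z|exists 0%R].
have i0 : (0 <= inf Z)%R by apply: lb_le_inf => //; exists z.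
have iz t : Z t -> (inf Z <= t)%R by move=> Zt; apply: ge_inf => //; exact: infZ.2.
exists (inf Z); split.
- by rewrite i0/= (le_trans (iz _ Zz))//; case/andP: zL.
- apply/eqP/negPn/negP => Fi.
  have e0 : (0 < `|F (inf Z)|)%R by rewrite normr_gt0.
  have /nbhs_ballP[d /= d0 hd] := cF (inf Z) _ (nbhsx_ballx (F (inf Z)) _ e0).
  have [t Zt ti] := inf_adherent d0 infZ.
  have := hd t; rewrite /ball/= Zt.2 subr0 ltxx => h.
  by suff : false by []; apply: h; rewrite distrC ger0_norm ?subr_ge0 ?iz//; lra.
- move=> r r0 ri Fr; have : Z r.
    by split => //; rewrite r0/= (le_trans (ltW ri))// (le_trans (iz _ Zz))//; case/andP: zL.
  by move=> /iz; rewrite leNgt ri.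
Qed.

(* If F vanishes somewhere, only the parts of [0, L] before its first and
   after its last zero contribute to |F 0 - F L|. *)
Lemma increments_off_zeros F g h (L : R) : (0 <= L)%R -> continuous F ->
  measurable_fun setT g -> (forall x, 0 <= g x) ->
  measurable_fun setT h -> (forall x, 0 <= h x) ->
  (forall x, (0 <= x <= L)%R -> F x <> 0%R -> g x <= h x) ->
  (forall s t : R, (0 <= s)%R -> (s < t)%R -> (t <= L)%R ->
    (forall r, (s < r < t)%R -> F r <> 0%R) ->
    `|F s - F t|%:E <= \int[mu]_(x in `[s, t]) g x) ->
  `|F 0%R - F L|%:E <= \int[mu]_(x in `[0%R, L]) h x.
Proof.
move=> L0 cF mg g0 mh h0 gh Fg.
have key s t : (0 <= s)%R -> (s <= t)%R -> (t <= L)%R ->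
    (forall r, (s < r < t)%R -> F r <> 0%R) ->
    `|F s - F t|%:E <= \int[mu]_(x in `[s, t]) h x.
  move=> s0; rewrite le_eqVlt => /predU1P[<- _ _|st tL F0].
    by rewrite subrr normr0 integral_ge0.
  rewrite (le_trans (Fg s t s0 st tL F0))//.
  rewrite -!(@integral_itv_bndo_bndc _ (BLeft s)); [|exact: measurable_funTS..].
  rewrite -!(@integral_itv_obnd_cbnd _ s); [|exact: measurable_funTS..].
  apply: ge0_le_integral => //; [exact: measurable_funTS..|].
  move=> x /=; rewrite in_itv/= => xst; apply: gh; last exact: F0.
  by case/andP: xst => sx xt; apply/andP; split; lra.
have [ex|nex] := pselect (exists2 z, (0 <= z <= L)%R & F z = 0%R); last first.
  apply: key => // r /andP[r0 rL] Fr; apply: nex; exists r => //.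
  by rewrite !ltW.
have [z1 [/andP[z10 z1L] Fz1 h1]] := first_zero cF ex.
(* The last zero of [F] is found as the first zero of its reflection. *)
have cF' : continuous (fun x => F (L - x)%R).
  move=> x; apply: (@continuous_comp _ _ _ (fun x => L - x)%R F); last exact: cF.
  by apply: cvgB; [exact: cvg_cst|exact: cvg_id].
have [z2' [/andP[z20 z2L] Fz2 h2]] : exists z, [/\ (0 <= z <= L)%R, F (L - z)%R = 0%R &
                forall r, (0 <= r)%R -> (r < z)%R -> F (L - r)%R <> 0%R].
  apply: (first_zero cF'); exists (L - z1)%R; first by apply/andP; split; lra.
  by rewrite subKr.
pose z2 := (L - z2')%R.
have z12 : (z1 <= z2)%R.
  by rewrite leNgt; apply/negP => /h1; apply => //; rewrite /z2 subr_ge0.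
have z2L' : (z2 <= L)%R by rewrite /z2; lra.
have i1 := key 0%R z1 (lexx _) z10 z1L (fun r rI => h1 r (ltW (andP rI).1) (andP rI).2).
have i2 : `|F z2 - F L|%:E <= \int[mu]_(x in `[z2, L]) h x.
  apply: key => //; first by rewrite /z2; lra.
  move=> r /andP[zr rL]; have := h2 (L - r)%R.
  by rewrite subKr; apply; move: zr; rewrite /z2; lra.
rewrite (ge0_integral_itv_split mh h0 z10 z1L) (ge0_integral_itv_split mh h0 z12 z2L').
have F0 : (`|F 0 - F L| <= `|F 0 - F z1| + `|F z2 - F L|)%R.
  by rewrite Fz1 /z2 Fz2 subr0 sub0r normrN ler_normB.
rewrite (le_trans (y := (`|F 0 - F z1| + `|F z2 - F L|)%:E)) ?lee_fin//.
by rewrite EFinD leeD// (le_trans i2)// leeDr// integral_ge0.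
Qed.

End interval_inequalities.

(** * Line integrals, energy and modulus *)

Section line_integrals.
Context {R : realType} {X : pmetricType R}.
Local Open Scope ereal_scope.
Implicit Types (E : set X) (u : X -> R) (g h rho : X -> \bar R) (c : curve X).

Lemma open_borel E : open E -> borel E.
Proof. by move=> oE; apply: sub_sigma_algebra. Qed.

Lemma closed_borel E : closed E -> borel E.
Proof.
move=> cE; rewrite /borel -(setCK E); apply: (@measurableC _ (borel_type X)).
by apply: open_borel; exact: closed_openC.
Qed.

Lemma borel_arcline c (B : set X) : rectifiable c -> borel B ->
  measurable (arcline c @^-1` B : set (measurableTypeR R)).
Proof.
move=> rc bB.
have : measurable_fun setT (arcline c : measurableTypeR R -> borel_type X).
  apply: (@measurability _ _ (measurableTypeR R) (borel_type X) setT (arcline c) (@open X)) => //= _ [V oV <-]; rewrite setTI.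
  apply: open_measurable; apply: open_comp => // x _.
  exact: arcline_continuous.
by move=> /(_ measurableT _ bB); rewrite setTI.
Qed.

Lemma arcline_measurable_fun E g c : borel E -> rectifiable c ->
  curve_in E c -> nonneg_borel E g -> measurable_fun setT (g \o arcline c : R -> \bar R).
Proof.
move=> bE rc cE [mg _] _ Y mY; rewrite setTI.
have -> : (g \o arcline c) @^-1` Y = arcline c @^-1` (E `&` g @^-1` Y).
  by apply/seteqP; split => [x Yx|x []//]; split => //; exact: arcline_in.
by apply: borel_arcline => //; exact: mg.
Qed.

Lemma arcline_fun_ge0 E g c : rectifiable c -> curve_in E c ->
  nonneg_borel E g -> forall r, 0 <= g (arcline c r).
Proof. by move=> rc cE [_ g0] r; apply: g0; exact: arcline_in. Qed.

Variables (E : set X).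
Hypothesis bE : borel E.

Lemma le_line_integral g h c : rectifiable c -> curve_in E c ->
  nonneg_borel E g -> nonneg_borel E h -> (forall x, E x -> g x <= h x) ->
  line_integral c g <= line_integral c h.
Proof.
move=> rc cE gE hE gh; rewrite !line_integralE//; apply: ge0_le_integral => //.
- by move=> r _; exact: (arcline_fun_ge0 rc cE gE).
- apply: measurable_funTS; exact: (arcline_measurable_fun bE rc cE gE).
- apply: measurable_funTS; exact: (arcline_measurable_fun bE rc cE hE).
- by move=> r _; apply: gh; exact: arcline_in.
Qed.

Lemma line_integralZ g c (k : R) : rectifiable c -> curve_in E c ->
  nonneg_borel E g -> (0 <= k)%R ->
  line_integral c (fun x => k%:E * g x) = k%:E * line_integral c g.
Proof.
move=> rc cE gE k0; rewrite !line_integralE// ge0_integralZl//.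
- apply: measurable_funTS; exact: (arcline_measurable_fun bE rc cE gE).
- by move=> r _; exact: (arcline_fun_ge0 rc cE gE).
Qed.

Lemma line_integralD g h c : rectifiable c -> curve_in E c ->
  nonneg_borel E g -> nonneg_borel E h ->
  line_integral c (fun x => g x + h x) = line_integral c g + line_integral c h.
Proof.
move=> rc cE gE hE; rewrite !line_integralE// ge0_integralD//.
- by move=> r _; exact: (arcline_fun_ge0 rc cE gE).
- apply: measurable_funTS; exact: (arcline_measurable_fun bE rc cE gE).
- by move=> r _; exact: (arcline_fun_ge0 rc cE hE).
- apply: measurable_funTS; exact: (arcline_measurable_fun bE rc cE hE).
Qed.

Lemma line_integral_cst c (k : R) : rectifiable c ->
  line_integral c (cst k%:E) = k%:E * curve_length c.
Proof.
move=> rc; rewrite /line_integral integral_cst//=.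
congr (_ * _); rewrite lebesgue_measure_itv/= lte_fin oppr0 adde0.
have := curve_length_ge0 c; rewrite le_eqVlt => /predU1P[e|->].
  by rewrite -e ltxx -(fineK (curve_length_fin rc)) -e.
by rewrite fineK// curve_length_fin.
Qed.

Lemma line_integral_ge0 g c : rectifiable c -> curve_in E c ->
  nonneg_borel E g -> 0 <= line_integral c g.
Proof.
move=> rc cE gE; rewrite line_integralE//; apply: integral_ge0 => r _.
exact: (arcline_fun_ge0 rc cE gE).
Qed.

Lemma upper_gradient_along_arcline u g c : rectifiable c ->
  upper_gradient_along u g c <->
  `|u (arcline c 0) - u (arcline c (fine (curve_length c)))|%:E <=
  \int[lebesgue_measure]_(r in `[0%R, fine (curve_length c)]) g (arcline c r).
Proof.
by move=> rc; rewrite arcline0// arclineL// -line_integralE.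
Qed.

End line_integrals.

Section nonneg_borel_closure.
Context {R : realType} {X : pmetricType R}.
Local Open Scope ereal_scope.
Implicit Types (E : set X) (g h : X -> \bar R).

Lemma nonneg_borelZ E g (k : R) : (0 <= k)%R -> nonneg_borel E g ->
  nonneg_borel E (fun x => k%:E * g x).
Proof.
move=> k0 [mg g0]; split; first exact: measurable_funeM.
by move=> x Ex; rewrite mule_ge0// g0.
Qed.

Lemma nonneg_borelD E g h : nonneg_borel E g -> nonneg_borel E h ->
  nonneg_borel E (fun x => g x + h x).
Proof.
move=> [mg g0] [mh h0]; split; first exact: emeasurable_funD.
by move=> x Ex; rewrite adde_ge0 ?g0 ?h0.
Qed.

Lemma nonneg_borel_min E g h : nonneg_borel E g -> nonneg_borel E h ->
  nonneg_borel E (fun x => mine (g x) (h x)).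
Proof.
move=> [mg g0] [mh h0]; split; first exact: measurable_mine.
by move=> x Ex; rewrite le_min g0// h0.
Qed.

Lemma nonneg_borel_cst E (k : \bar R) : 0 <= k -> nonneg_borel E (cst k).
Proof. by move=> k0; split => //; exact: measurable_cst. Qed.

Lemma nonneg_borelS E E' g : borel E -> E' `<=` E ->
  nonneg_borel E g -> nonneg_borel E' g.
Proof.
move=> bE EE [mg g0]; split; first exact: measurable_funS mg.
by move=> x /EE; exact: g0.
Qed.

Lemma nonneg_borel_restrict E g : borel E -> nonneg_borel E g ->
  nonneg_borel setT (g \_ E).
Proof.
move=> bE [mg g0]; split; first by apply/(measurable_restrictT _ _).1.
by move=> x _; rewrite patchE; case: ifPn => // /set_mem; exact: g0.
Qed.

End nonneg_borel_closure.

Lemma nneseries_half_lty (R : realType) (a : nat -> \bar R) :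
  (forall n, (a n <= (1 / (2 ^ n.+1)%:R)%:E)%E) ->
  (forall n, (0 <= a n)%E) -> (\sum_(0 <= n <oo) a n < +oo)%E.
Proof.
move=> ha a0; apply: (@le_lt_trans _ _ 1%E); last exact: ltry.
have := @epsilon_trick R (cst 0%E) 1 xpredT (fun _ => lexx _) ler01.
rewrite [X in (_ <= X + _)%E]eseries0// add0e; apply: le_trans; apply: lee_nneseries => // n _.
by rewrite add0e.
Qed.

Section energy.
Context {R : realType} {X : pmetricType R}.
Local Open Scope ereal_scope.
Variable mu : {outer_measure set X -> \bar R}.
Hypothesis hB : forall B : set X, borel B -> mu.-caratheodory B.
Implicit Types (E : set X) (g h rho : X -> \bar R) (c : curve X).
Local Notation M := (caratheodory_type mu).

Lemma borel_caratheodory_fun E g : borel E -> borel_fun E g ->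
  measurable_fun (E : set M) (g : M -> \bar R).
Proof. by move=> bE mg mE Y mY; apply: hB; exact: mg. Qed.

(** A set of outer measure zero is Carathéodory measurable, so the exceptional set serves as its own
    measurable cover. *)
Lemma aeP (P : X -> Prop) :
  {ae (mu : set M -> \bar R), forall x, P x} <-> mu [set x | ~ P x] = 0.
Proof.
split=> [[N [mN N0 PN]]|P0].
  apply/eqP; rewrite eq_le outer_measure_ge0 andbT -[X in _ <= X]N0.
  exact: le_outer_measure.
exists [set x | ~ P x]; split => //.
apply: le_caratheodory_measurable => Z.
have -> : mu (Z `&` [set x | ~ P x]) = 0.
  by apply/eqP; rewrite eq_le outer_measure_ge0 andbT -P0 le_outer_measure.
by rewrite add0e le_outer_measure.
Qed.

Lemma ae_carS (P Q : X -> Prop) : (forall x, P x -> Q x) ->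
  {ae (mu : set M -> \bar R), forall x, P x} ->
  {ae (mu : set M -> \bar R), forall x, Q x}.
Proof.
move=> PQ [N [mN N0 PN]]; exists N; split => // x /= nQ; apply: PN => /= Px.
exact/nQ/PQ.
Qed.

Lemma ae_car_all (P : nat -> X -> Prop) :
  (forall n, {ae (mu : set M -> \bar R), forall x, P n x}) ->
  {ae (mu : set M -> \bar R), forall x, forall n, P n x}.
Proof.
move=> Pn; apply/aeP; apply/eqP; rewrite eq_le outer_measure_ge0 andbT.
have sub : [set x | ~ (forall n, P n x)] `<=` \bigcup_n [set x | ~ P n x].
  by move=> x /= /existsNP[n nP]; exists n.
apply: (le_trans (le_outer_measure mu _ _ sub)).
apply: (le_trans (outer_measure_sigma_subadditive mu _)).
by rewrite eseries0// => n _ _; exact/aeP.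
Qed.

Lemma ae_car_and (P Q : X -> Prop) :
  {ae (mu : set M -> \bar R), forall x, P x} ->
  {ae (mu : set M -> \bar R), forall x, Q x} ->
  {ae (mu : set M -> \bar R), forall x, P x /\ Q x}.
Proof.
move=> aP aQ; apply: (@ae_carS (fun x => forall n : nat, if n is 0%N then P x else Q x)).
  by move=> x h; split; [exact: (h 0%N)|exact: (h 1%N)].
by apply: ae_car_all => -[].
Qed.

Variable p : R.
Hypothesis p0 : (0 < p)%R.

Lemma measurable_energy E g : borel E -> borel_fun E g ->
  measurable_fun (E : set M) (fun x : M => g x `^ p).
Proof.
move=> bE mg; apply: (measurableT_comp (measurable_poweR p)).
exact: borel_caratheodory_fun.
Qed.

Lemma energy_ge0 E g : 0 <= energy mu p E g.
Proof. by apply: integral_ge0 => x _; exact: poweR_ge0. Qed.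

Lemma le_energy E g h : borel E -> nonneg_borel E g -> nonneg_borel E h ->
  (forall x, E x -> g x <= h x) -> energy mu p E g <= energy mu p E h.
Proof.
move=> bE [mg g0] [mh h0] gh; apply: ge0_le_integral => //.
- exact: hB.
- by move=> x _; exact: poweR_ge0.
- exact: measurable_energy.
- exact: measurable_energy.
- move=> x Ex; apply: gt0_ler_poweR; rewrite ?(ltW p0)// ?in_itv/= ?leey ?andbT ?g0 ?h0//.
  exact: gh.
Qed.

Lemma ae_le_energy E g h : borel E -> nonneg_borel E g -> nonneg_borel E h ->
  {ae (mu : set M -> \bar R), forall x, E x -> g x <= h x} ->
  energy mu p E g <= energy mu p E h.
Proof.
move=> bE [mg g0] [mh h0] gh; apply: ae_ge0_le_integral => //.
- exact: hB.
- by move=> x _; exact: poweR_ge0.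
- exact: measurable_energy.
- by move=> x _; exact: poweR_ge0.
- exact: measurable_energy.
- apply: (ae_carS _ gh) => x {}gh Ex; apply: gt0_ler_poweR; rewrite ?(ltW p0)// ?in_itv/= ?leey ?andbT ?g0 ?h0//.
  exact: gh.
Qed.

Lemma energyZ E g (k : R) : borel E -> nonneg_borel E g -> (0 <= k)%R ->
  energy mu p E (fun x => k%:E * g x) = (k `^ p)%:E * energy mu p E g.
Proof.
move=> bE [mg g0] k0; rewrite /energy -ge0_integralZl//.
- by apply: eq_integral => x; rewrite inE => Ex; rewrite poweRM// ?g0// poweR_EFin.
- exact: hB.
- exact: measurable_energy.
- by move=> x _; exact: poweR_ge0.
- by rewrite lee_fin powR_ge0.
Qed.

Lemma energyS E E' g : borel E -> borel E' -> E' `<=` E -> nonneg_borel E g ->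
  energy mu p E' g <= energy mu p E g.
Proof.
move=> bE bE' EE [mg g0]; apply: ge0_subset_integral => //.
- exact: hB.
- exact: hB.
- exact: measurable_energy.
- by move=> x _; exact: poweR_ge0.
Qed.

Lemma energy_restrict E E' g : energy mu p E (g \_ E') = energy mu p (E `&` E') g.
Proof.
rewrite /energy integral_mkcondr; apply: eq_integral => x _.
by rewrite !patchE; case: ifPn => //; rewrite poweR0r// gt_eqF.
Qed.

(* The l^p sum replaces Minkowski's inequality: it dominates every term and
   its energy is the sum of the energies. *)
Lemma lp_sum_rho E (rho : nat -> X -> \bar R) : borel E ->
  (forall n, nonneg_borel E (rho n)) ->
  (\sum_(0 <= n <oo) energy mu p E (rho n) < +oo) ->
  exists r, [/\ nonneg_borel E r, energy mu p E r < +oo &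
    forall n x, E x -> rho n x <= r x].
Proof.
move=> bE hr hs.
pose S x := \sum_(0 <= n <oo) (rho n x `^ p).
have mS : borel_fun E S.
  apply: ge0_emeasurable_sum => [k x _ _|k _]; first exact: poweR_ge0.
  exact: (measurableT_comp (measurable_poweR p) (hr k).1).
have S0 x : 0 <= S x by apply: nneseries_ge0 => n _ _; exact: poweR_ge0.
exists (fun x => S x `^ p^-1); split.
- split; first exact: (measurableT_comp (measurable_poweR p^-1) mS).
  by move=> x _; exact: poweR_ge0.
- have -> : energy mu p E (fun x => S x `^ p^-1) = energy mu 1 E S.
    apply: eq_integral => x _.
    by rewrite -poweRrM mulVf ?gt_eqF// poweRe1// poweRe1.
  rewrite /energy; under eq_integral do rewrite poweRe1//.
  rewrite integral_nneseries//; first exact: hB.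
    by move=> n; apply: measurable_energy => //; exact: (hr n).1.
  by move=> n x _; exact: poweR_ge0.
- move=> n x Ex; have r0 := (hr n).2 x Ex.
  have -> : rho n x = (rho n x `^ p) `^ p^-1.
    by rewrite -poweRrM divff ?gt_eqF// poweRe1.
  apply: gt0_ler_poweR; rewrite ?in_itv/= ?leey ?andbT ?poweR_ge0 ?invr_ge0 ?(ltW p0)//.
  have := @nneseries_lim_ge _ (fun n => rho n x `^ p) xpredT 0 n.+1 (fun _ _ _ => poweR_ge0 _ _).
  apply: le_trans; rewrite big_nat_recr//= leeDr// sume_ge0// => i _.
  exact: poweR_ge0.
Qed.

Lemma energy_scale_small E g (e : R) : borel E -> nonneg_borel E g ->
  energy mu p E g < +oo -> (0 < e)%R -> exists2 k : R, (0 < k)%R &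
  energy mu p E (fun x => k%:E * g x) <= e%:E.
Proof.
move=> bE gE goo e0.
have gfin : energy mu p E g \is a fin_num by rewrite ge0_fin_numE ?energy_ge0.
have f0 : (0 <= fine (energy mu p E g))%R by rewrite fine_ge0 ?energy_ge0.
have q0 : (0 < e / (fine (energy mu p E g) + 1))%R by rewrite divr_gt0// ltr_wpDl.
exists ((e / (fine (energy mu p E g) + 1)) `^ p^-1)%R; first exact: powR_gt0.
rewrite energyZ ?powR_ge0// -powRrM mulVf ?gt_eqF// powRr1 ?(ltW q0)//.
rewrite -[X in _ * X](fineK gfin) -EFinM lee_fin -mulrA ler_piMr ?(ltW e0)//.
by rewrite mulrC ler_pdivrMr ?mul1r ?lerDl// ltr_wpDl.
Qed.

(** The two energies are equal and finite, so the nonnegative difference of the p-th powers has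
    integral zero. *)
Lemma ae_le_of_energy E g h : borel E -> nonneg_borel E g -> nonneg_borel E h ->
  (forall x, E x -> h x <= g x) -> energy mu p E g <= energy mu p E h ->
  energy mu p E g < +oo ->
  {ae (mu : set M -> \bar R), forall x, E x -> g x <= h x}.
Proof.
move=> bE gE hE hg le goo.
pose f x := g x `^ p; pose k x := h x `^ p.
have f0 x : 0 <= f x by exact: poweR_ge0.
have k0 x : 0 <= k x by exact: poweR_ge0.
have kf x : E x -> k x <= f x.
  move=> Ex; apply: gt0_ler_poweR; rewrite ?(ltW p0)// ?in_itv/= ?leey ?andbT ?gE.2 ?hE.2//.
  exact: hg.
have mE : measurable (E : set M) by exact: hB.
have mf : measurable_fun (E : set M) (f : M -> \bar R) by exact: measurable_energy gE.1.
have mk : measurable_fun (E : set M) (k : M -> \bar R) by exact: measurable_energy hE.1.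
(* The truncation makes [f = k + d] true also where both are +oo, since there the difference is -oo
   by convention. *)
pose d x := maxe (f x - k x) 0.
have d0 x : 0 <= d x by rewrite /d le_max lexx orbT.
have md : measurable_fun (E : set M) (d : M -> \bar R).
  by apply: measurable_maxe => //; exact: emeasurable_funB.
have fkd x : E x -> f x = k x + d x.
  move=> Ex; rewrite /d; move: (kf x Ex) (k0 x) (f0 x).
  case: (f x) => [a||] //; case: (k x) => [b||] //=.
    by rewrite lee_fin => ba _ _; rewrite (max_idPl _) ?lee_fin ?subr_ge0// -EFinB -EFinD addrC subrK.
  by move=> _ _ _; rewrite addye// -ltNye (@lt_le_trans _ _ 0)// le_max lexx orbT.
have e1 : energy mu p E g = energy mu p E h + \int[(mu : set M -> \bar R)]_(x in (E : set M)) d x.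
  rewrite /energy -ge0_integralD//; last by move=> x _; exact: k0.
  by apply: eq_integral => x; rewrite inE => Ex; rewrite -/(f x) fkd.
have hfin : energy mu p E h \is a fin_num.
  rewrite ge0_fin_numE ?energy_ge0//; apply: le_lt_trans goo.
  exact: le_energy.
have i0 : 0 <= \int[(mu : set M -> \bar R)]_(x in (E : set M)) d x by exact: integral_ge0.
have id0 : \int[(mu : set M -> \bar R)]_(x in (E : set M)) `|d x| = 0.
  under eq_integral do rewrite gee0_abs//.
  apply/eqP; rewrite eq_le i0 andbT.
  by move: le; rewrite e1 -[leRHS]adde0 leeD2lE.
have := (ae_eq_integral_abs _ mE md).1 id0.
apply: ae_carS => x hx Ex; have dx := hx Ex.
have : f x <= k x by rewrite fkd// dx adde0.
move=> fk; have g0 := gE.2 x Ex; have h0 := hE.2 x Ex.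
have rt (y : \bar R) : 0 <= y -> y = (y `^ p) `^ p^-1.
  by move=> y0; rewrite -poweRrM divff ?gt_eqF// poweRe1.
rewrite (rt _ g0) (rt _ h0).
by apply: gt0_ler_poweR; rewrite ?in_itv/= ?leey ?andbT ?poweR_ge0 ?invr_ge0 ?(ltW p0).
Qed.

End energy.

Lemma open_mball {R : realType} {X : pmetricType R} (x : X) (r : R) :
  open (ball x r).
Proof.
rewrite openE => y; rewrite ballEmdist/= => xy; apply/nbhs_ballP.
exists (r - mdist x y); first by rewrite /= subr_gt0.
move=> z /=; rewrite !ballEmdist/= => yz.
by rewrite (le_lt_trans (metric_triangle x y z))// -ltrBrDl.
Qed.

(** * Almost every curve and families of modulus zero *)

Section almost_every_curve.
Context {R : realType} {X : pmetricType R}.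
Local Open Scope ereal_scope.
Variable mu : {outer_measure set X -> \bar R}.
Hypothesis hB : forall B : set X, borel B -> mu.-caratheodory B.
Variable p : R.
Hypothesis p0 : (0 < p)%R.
Implicit Types (E : set X) (u : X -> R) (g h rho : X -> \bar R) (c : curve X)
  (P Q : curve X -> Prop).
Local Notation M := (caratheodory_type mu).

(** By [modulus0P] this means that [P] fails only on a family of curves of modulus zero. The
    explicit witness [rho] serves subcurves as well, since its integral over a subcurve is no
    larger. *)
Definition ae_curve E P : Prop := exists rho,
  [/\ nonneg_borel E rho, energy mu p E rho < +oo &
      forall c, rectifiable c -> curve_in E c -> line_integral c rho < +oo -> P c].

Lemma ae_curveW E P Q : (forall c, rectifiable c -> curve_in E c -> P c -> Q c) ->
  ae_curve E P -> ae_curve E Q.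
Proof.
move=> PQ [rho [rE roo rP]]; exists rho; split => // c rc cE cr.
by apply: PQ => //; exact: rP.
Qed.

Lemma ae_curve_fin E g : nonneg_borel E g -> energy mu p E g < +oo ->
  ae_curve E (fun c => line_integral c g < +oo).
Proof. by move=> gE goo; exists g; split. Qed.

(** Scaled so that their energies are summable, the witnesses have an l^p sum of finite energy,
    which is a witness for all n at once. *)
Lemma ae_curve_all E (P : nat -> curve X -> Prop) : borel E ->
  (forall n, ae_curve E (P n)) -> ae_curve E (fun c => forall n, P n c).
Proof.
move=> bE /choice[rho hrho].
have e0 n : (0 < 1 / (2 ^ n.+1)%:R :> R)%R by rewrite divr_gt0// ltr0n expn_gt0.
have h n : exists k : R, (0 < k)%R /\
    energy mu p E (fun x => k%:E * rho n x) <= (1 / (2 ^ n.+1)%:R)%:E.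
  have [h1 h2 _] := hrho n.
  by have [k k0 ke] := energy_scale_small hB p0 bE h1 h2 (e0 n); exists k.
have [k hk] := choice h.
have kE n : nonneg_borel E (fun x => (k n)%:E * rho n x).
  by apply: nonneg_borelZ; [exact/ltW/(hk n).1|have [] := hrho n].
have [|r [rE roo hr]] := @lp_sum_rho _ _ mu hB p p0 E (fun n x => (k n)%:E * rho n x) bE kE.
  apply: nneseries_half_lty => n; first exact: (hk n).2.
  exact: energy_ge0.
exists r; split => // c rc cE cr n; have [rnE _] := hrho n; apply => //.
have := le_line_integral bE rc cE (kE n) rE (hr n).
rewrite (line_integralZ bE)//; last exact/ltW/(hk n).1.
move=> /le_lt_trans/(_ cr).
have := line_integral_ge0 rc cE rnE.
case: (line_integral c (rho n)) => [x|_|]//; rewrite ?ltry//.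
by rewrite gt0_muley// lte_fin; exact: (hk n).1.
Qed.

Lemma ae_curve_and E P Q : borel E -> ae_curve E P -> ae_curve E Q ->
  ae_curve E (fun c => P c /\ Q c).
Proof.
move=> bE aP aQ.
apply: (@ae_curveW E (fun c => forall n : nat, (if n is 0%N then P else Q) c)).
  by move=> c _ _ h; split; [exact: (h 0%N)|exact: (h 1%N)].
by apply: ae_curve_all => // -[].
Qed.

Lemma modulus_ge0 E (Gamma : set (curve X)) : 0 <= modulus mu p E Gamma.
Proof. by apply: le_ereal_inf_tmp => _ [rho _ <-]; exact: energy_ge0. Qed.

(** From modulus zero, choose admissible [rho n] with [n.+1 * rho n] of energy at most 2^-(n+1). The
    l^p sum of these multiples has integral at least n + 1, for every n, over each exceptional
    curve. Conversely a witness has infinite integral over exceptional curves, so all its small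
    multiples are admissible. *)
Lemma modulus0P E P : borel E ->
  modulus mu p E [set c | [/\ rectifiable c, curve_in E c & ~ P c]] = 0 <->
  ae_curve E P.
Proof.
move=> bE; split=> [m0|[rho [rE roo rP]]].
  have h n : exists rho, [/\ nonneg_borel E rho,
      forall c, rectifiable c -> curve_in E c -> ~ P c -> 1 <= line_integral c rho &
      energy mu p E (fun x => n.+1%:R%:E * rho x) <= (1 / (2 ^ n.+1)%:R)%:E].
    have n0 : (0 < n.+1%:R `^ p :> R)%R by rewrite powR_gt0.
    have e0 : (0 < (1 / (2 ^ n.+1)%:R) / (n.+1%:R `^ p) :> R)%R.
      by rewrite divr_gt0// divr_gt0// ltr0n expn_gt0.
    have [] := @lb_ereal_inf_adherent _ [set energy mu p E rho | rho in [set rho | nonneg_borel E rho /\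
    forall c, [set c | [/\ rectifiable c, curve_in E c & ~ P c]] c -> rectifiable c -> 1 <= line_integral c rho]] _ e0.
      by rewrite -/(modulus _ _ _ _) m0.
    move=> _ [rho [rE hr] <-]; rewrite -/(modulus _ _ _ _) m0 add0e => lt.
    exists rho; split => //; first by move=> c rc cE nP; exact: hr.
    rewrite energyZ// (le_trans (lee_wpmul2l _ (ltW lt)))//.
    by rewrite -EFinM lee_fin mulrC divfK// gt_eqF.
  have [rho hrho] := choice h.
  have kE n : nonneg_borel E (fun x => n.+1%:R%:E * rho n x).
    by apply: nonneg_borelZ => //; have [] := hrho n.
  have [|r [rE roo hr]] := @lp_sum_rho _ _ mu hB p p0 E (fun n x => n.+1%:R%:E * rho n x) bE kE.
    apply: nneseries_half_lty => n; first by have [] := hrho n.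
    exact: energy_ge0.
  exists r; split => // c rc cE cr; apply: contrapT => nP.
  have big n : n.+1%:R%:E <= line_integral c r.
    have [rnE h1 _] := hrho n.
    apply: le_trans (le_line_integral bE rc cE (kE n) rE (hr n)).
    rewrite (line_integralZ bE)// -[X in X <= _]mule1 lee_wpmul2l//.
    exact: h1.
  have fin : line_integral c r \is a fin_num.
    by rewrite ge0_fin_numE// (line_integral_ge0 rc cE rE).
  have := big (Num.truncn (fine (line_integral c r))).
  by rewrite -(fineK fin) lee_fin leNgt/= truncnS_gt.
apply/eqP; rewrite eq_le modulus_ge0 andbT; apply/lee_addgt0Pr => e e0.
rewrite add0e; have [k k0 ke] := energy_scale_small hB p0 bE rE roo e0.
apply: le_trans ke; apply: ereal_inf_lbound; exists (fun x => k%:E * rho x) => //.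
split; first exact/nonneg_borelZ/rE/ltW.
move=> c [_ cE nP] rc; rewrite (line_integralZ bE)// ?(ltW k0)//.
suff -> : line_integral c rho = +oo by rewrite gt0_muley ?leey// lte_fin.
by apply/eqP; rewrite -leye_eq leNgt; apply/negP => /(rP c rc cE).
Qed.

Lemma weak_upper_gradientP E u g : borel E ->
  weak_upper_gradient mu p E u g <->
  nonneg_borel E g /\ ae_curve E (upper_gradient_along u g).
Proof. by move=> bE; split => -[gE /(modulus0P _ bE) h]; split. Qed.

Lemma upper_gradient_weak E u g : borel E -> upper_gradient E u g ->
  weak_upper_gradient mu p E u g.
Proof.
move=> bE [gE h]; apply/(weak_upper_gradientP _ _ bE); split => //.
exists (cst 0); split; first exact: nonneg_borel_cst.
  by rewrite /energy integral0_eq// => x _; rewrite poweR0r// gt_eqF.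
by move=> c rc cE _; exact: h.
Qed.

Hypothesis hsep : separable_space X.

(** A Lindelöf argument: enumerate the balls with centre in a countable dense set and radius 1 / (k
    + 1), and replace by the empty set those on which the energy is infinite. *)
Lemma locally_Lp_cover E g : locally_Lp mu p E g -> borel E -> nonneg_borel E g ->
  exists V : nat -> set X, [/\ forall n, open (V n),
    forall n, energy mu p (E `&` V n) g < +oo & E `<=` \bigcup_n V n].
Proof.
move=> lg bE gE; have [D cD dD] := hsep.
have D0 : D !=set0.
  by have [|x [_ Dx]] := dD setT _ openT; [exists point|exists x].
have /countable_injP[f finj] := cD.
pose e m := xget point [set x | D x /\ f x = m].
have De x : D x -> e (f x) = x.
  move=> Dx; rewrite /e; case: xgetP => [y _ [Dy fy]|/(_ x)[]//].
  by apply: finj; rewrite ?inE.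
pose B i := if unpickle i is Some (n, k) then ball (e n) (k.+1%:R^-1 : R)%R else set0.
have oB i : open (B i).
  by rewrite /B; case: unpickle => [[n k]|]; [exact: open_mball|exact: open0].
exists (fun i => if `[< energy mu p (E `&` B i) g < +oo >] then B i else set0).
split=> [n|n|x Ex]; first by case: asboolP => // _; exact: open0.
  by case: asboolP => // _; rewrite setI0 /energy integral_set0.
have [V [oV Vx Voo]] := lg x Ex.
have := oV; rewrite openE => /(_ x Vx) /nbhs_ballP[r /= r0 rV].
have [k kr] : exists k : nat, (k.+1%:R^-1 < r / 2)%R.
  exists (Num.truncn (r / 2)^-1).
  rewrite invf_plt ?posrE ?divr_gt0// ?ltr0n// -[ltRHS]/(_%:R)%R.
  exact: truncnS_gt.
have k0 : (0 < k.+1%:R^-1 :> R)%R by rewrite invr_gt0.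
have [|d [dx Dd]] := dD (ball x (k.+1%:R^-1)%R) _ (open_mball _ _).
  by exists x; rewrite ballEmdist/= mdistxx.
have Bx : B (pickle (f d, k)) = ball d (k.+1%:R^-1)%R by rewrite /B pickleK De.
exists (pickle (f d, k)) => //; case: asboolP; rewrite Bx => h; first exact: ball_sym.
exfalso; apply: h; apply: le_lt_trans Voo; apply: energyS => //.
- by apply: measurableI => //; exact: open_borel.
- by apply: measurableI => //; apply: open_borel; exact: open_mball.
- apply: setIS => y dy; apply: rV; have := ball_triangle dx dy.
  by apply: le_ball; rewrite [leRHS]splitr lerD// ltW.
- by apply: nonneg_borelS gE => // y [].
Qed.

End almost_every_curve.

(** * Minimal weak upper gradients *)

Section minimal_gradient.
Context {R : realType} {X : pmetricType R}.
Local Open Scope ereal_scope.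
Variable mu : {outer_measure set X -> \bar R}.
Hypothesis hB : forall B : set X, borel B -> mu.-caratheodory B.
Hypothesis hsep : separable_space X.
Variable p : R.
Hypothesis p0 : (0 < p)%R.
Variable E : set X.
Hypothesis bE : borel E.
Implicit Types (u : X -> R) (g h rho : X -> \bar R) (c : curve X).
Local Notation M := (caratheodory_type mu).
Local Notation aec := (ae_curve mu p E).
Local Notation wug := (weak_upper_gradient mu p E).
Local Notation length c := (fine (curve_length c)).

Lemma nonneg_borel_restrictS g (V : set X) : borel V -> nonneg_borel E g ->
  nonneg_borel E (g \_ V).
Proof.
move=> bV [mg g0]; split.
  apply/(measurable_restrict _ _ _) => //.
  by apply: measurable_funS mg => // x [].
by move=> x Ex; rewrite patchE; case: ifPn => // _; exact: g0.
Qed.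

(** The hypothesis on [rho] applies to every subcurve of [c], because the integral of [rho] over it
    is bounded by the one over [c]. *)
Lemma increments_bounded_arcline u g c rho : nonneg_borel E rho ->
  nonneg_borel E g ->
  (forall c', rectifiable c' -> curve_in E c' -> line_integral c' rho < +oo ->
     upper_gradient_along u g c') ->
  rectifiable c -> curve_in E c -> line_integral c rho < +oo ->
  increments_bounded (u \o arcline c) (g \o arcline c) (length c).
Proof.
move=> rE gE h rc cE cr s t s0 st tL.
have [c' [rc' c's c't c'in c'int]] := exists_subcurve rc s0 st tL.
have c'E : curve_in E c'.
  by move=> r rI; have [z _ ->] := c'in r rI; exact: arcline_in.
have /= mg := arcline_measurable_fun bE rc cE gE.
have mr := arcline_measurable_fun bE rc cE rE.
have g0 := arcline_fun_ge0 rc cE gE; have r0 := arcline_fun_ge0 rc cE rE.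
rewrite /= -c's -c't -(c'int g mg g0); apply: h => //.
rewrite (c'int rho mr r0); apply: le_lt_trans cr; rewrite line_integralE//.
apply: ge0_subset_integral => //; first exact: measurable_funTS.
by move=> z /=; rewrite !in_itv/= => /andP[sz zt]; rewrite (le_trans s0)// (le_trans zt).
Qed.

(** On almost every curve [g] has finite integral over the part in each of countably many open sets
    covering [E]. Short pieces of the curve lie in one of them, and finitely many pieces make up the
    curve. *)
Lemma ae_curve_locally_Lp g : nonneg_borel E g -> locally_Lp mu p E g ->
  aec (fun c => line_integral c g < +oo).
Proof.
move=> gE lg; have [V [oV Voo EV]] := locally_Lp_cover hB hsep lg bE gE.
have VE n := nonneg_borel_restrictS (open_borel (oV n)) gE.
apply: (@ae_curveW _ _ _ _ _ (fun c => forall n, line_integral c (g \_ (V n)) < +oo)); last first.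
  apply: ae_curve_all => // n; apply: ae_curve_fin => //.
  by rewrite energy_restrict.
move=> c rc cE cV; rewrite line_integralE//.
have mg : measurable_fun setT (g \o arcline c : R -> \bar R) := arcline_measurable_fun bE rc cE gE.
have g0 := arcline_fun_ge0 rc cE gE.
have L0 := curve_length_ge0 c.
apply: (@interval_chain _ (fun s t => \int[lebesgue_measure]_(r in `[s, t]) (g \o arcline c) r < +oo) 0%R (length c)) => //.
  by move=> s t r s0 st tr rL h1 h2; rewrite (ge0_integral_itv_split mg g0 st tr) lte_add_pinfty.
move=> x xL; have [n _ Vn] := EV _ (arcline_in rc x cE).
have /nbhs_ballP[d /= d0 hd] : nbhs x (arcline c @^-1` V n).
  by apply: arcline_continuous => //; move: (oV n); rewrite openE; apply.
exists d => // s t s0 st tL sx tx.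
apply: le_lt_trans (cV n); rewrite line_integralE//.
have mgV : measurable_fun setT (g \_ (V n) \o arcline c : R -> \bar R) :=
  arcline_measurable_fun bE rc cE (VE n).
have gV0 := arcline_fun_ge0 rc cE (VE n).
apply: (@le_trans _ _ (\int[lebesgue_measure]_(r in `[s, t]) (g \_ (V n) \o arcline c) r)).
  apply: ge0_le_integral => //; [exact: measurable_funTS..|].
  move=> r /=; rewrite in_itv/= => /andP[sr rt]; rewrite patchE mem_set//.
  apply: hd; rewrite /ball/=; move: sx tx; rewrite !ltr_norml => /andP[? ?] /andP[? ?].
  by apply/andP; split; lra.
apply: ge0_subset_integral => //; first exact: measurable_funTS.
  by move=> r _; exact: gV0.
by move=> z /=; rewrite !in_itv/= => /andP[sz zt]; rewrite (le_trans s0)// (le_trans zt).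
Qed.

Lemma le_locally_Lp g h : nonneg_borel E g -> nonneg_borel E h ->
  (forall x, E x -> g x <= h x) -> locally_Lp mu p E h -> locally_Lp mu p E g.
Proof.
move=> gE hE gh lh x Ex; have [V [oV Vx Voo]] := lh x Ex; exists V; split => //.
have bV : borel (E `&` V) by apply: measurableI => //; exact: open_borel.
have sV : E `&` V `<=` E by move=> y [].
apply: le_lt_trans Voo; apply: le_energy => //.
- exact: nonneg_borelS gE.
- exact: nonneg_borelS hE.
- by move=> y [Ey _]; exact: gh.
Qed.

Lemma weak_upper_gradient_min u g h : wug u g -> locally_Lp mu p E g ->
  wug u h -> locally_Lp mu p E h -> wug u (fun x => mine (g x) (h x)).
Proof.
move=> /(weak_upper_gradientP hB p0 _ _ bE)[gE ag] lg.
move=> /(weak_upper_gradientP hB p0 _ _ bE)[hE ah] lh.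
apply/(weak_upper_gradientP hB p0 _ _ bE); split; first exact: nonneg_borel_min.
have := ae_curve_and hB p0 bE (ae_curve_and hB p0 bE ag ah)
  (ae_curve_and hB p0 bE (ae_curve_locally_Lp gE lg) (ae_curve_locally_Lp hE lh)).
move=> [rho [rE roo hrho]]; exists rho; split => // c rc cE cr.
have [[_ _] [goo hoo]] := hrho c rc cE cr.
have Fg : increments_bounded (u \o arcline c) (g \o arcline c) (length c).
  by apply: (increments_bounded_arcline rE) => // c' rc' c'E c'r; have [[]] := hrho c' rc' c'E c'r.
have Fh : increments_bounded (u \o arcline c) (h \o arcline c) (length c).
  by apply: (increments_bounded_arcline rE) => // c' rc' c'E c'r; have [[]] := hrho c' rc' c'E c'r.
apply/upper_gradient_along_arcline => //.
apply: (increments_bounded_min _ _ _ _ _ Fg Fh).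
- exact: curve_length_ge0.
- exact: arcline_measurable_fun gE.
- exact: arcline_fun_ge0 gE.
- exact: arcline_measurable_fun hE.
- exact: arcline_fun_ge0 hE.
- by move: goo; rewrite line_integralE.
- by move: hoo; rewrite line_integralE.
Qed.

(** Dominated convergence along a curve; [m 0] dominates and is integrable on almost every curve. *)
Lemma weak_upper_gradient_inf u (m : nat -> X -> \bar R) :
  (forall n, wug u (m n)) -> (forall n x, m n.+1 x <= m n x) ->
  locally_Lp mu p E (m 0%N) -> wug u (fun x => ereal_inf (range (m^~ x))).
Proof.
move=> hm dm lm.
have mE n : nonneg_borel E (m n) by case: (hm n).
have dec x : nonincreasing_seq (m^~ x) by apply/nonincreasing_seqP => n; exact: dm.
have infE : nonneg_borel E (fun x => ereal_inf (range (m^~ x))).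
  split; last first.
    by move=> x Ex; apply: le_ereal_inf_tmp => _ [n _ <-]; exact: (mE n).2.
  have -> : (fun x => ereal_inf (range (m^~ x))) = fun x => einfs (m^~ x) 0%N.
    apply/funext => x; rewrite /einfs; congr ereal_inf.
    by apply/seteqP; split => _ [n _ <-]; exists n.
  by apply: (@measurable_fun_einfs _ (borel_type X)) => n; exact: (mE n).1.
apply/(weak_upper_gradientP hB p0 _ _ bE); split => //.
have am n : aec (upper_gradient_along u (m n)).
  by have /(weak_upper_gradientP hB p0 _ _ bE)[] := hm n.
apply: (ae_curveW _ (ae_curve_and hB p0 bE (ae_curve_all hB p0 bE am)
  (ae_curve_locally_Lp (mE 0%N) lm))).
move=> c rc cE [cm c0]; rewrite /upper_gradient_along.
have mm n : measurable_fun setT (m n \o arcline c : R -> \bar R) :=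
  arcline_measurable_fun bE rc cE (mE n).
have m0 n := arcline_fun_ge0 rc cE (mE n).
have [||||||_ _] := @dominated_convergence _ _ _ (@lebesgue_measure R) `[0%R, length c]%classic _
  (fun n => m n \o arcline c) (fun r => ereal_inf (range (m^~ (arcline c r)))) (m 0%N \o arcline c).
- exact: measurable_itv.
- by move=> n; apply: measurable_funTS; exact: mm.
- by apply: measurable_funTS; exact: arcline_measurable_fun infE.
- by apply: aeW => r _; apply: ereal_nonincreasing_cvgn; exact: dec.
- apply/integrableP; split; first by apply: measurable_funTS; exact: mm.
  under eq_integral do rewrite (gee0_abs (m0 0%N _)).
  by move: c0; rewrite line_integralE.
- by apply: aeW => r n _; rewrite (gee0_abs (m0 n r)); exact: dec.
rewrite line_integralE// => cv; rewrite -(cvg_lim _ cv)//.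
apply: lime_ge; first by apply/cvg_ex; eexists; exact: cv.
by apply: nearW => n; have := cm n; rewrite /upper_gradient_along line_integralE.
Qed.

(** The energy on all of [E] may be infinite, so it is minimized on each of countably many sets
    [V n] of finite energy. [G (n, k)] is within 1 / (k + 1) of the infimum on [V n]. The infimum
    [g] of the running minima of all of them attains every one of these infima, so [min(g, h)]
    cannot have smaller energy than [g] on any [V n]. *)
Lemma minimal_weak_upper_gradient_exists u g0 : wug u g0 ->
  locally_Lp mu p E g0 -> exists g, minimal_weak_upper_gradient mu p E u g.
Proof.
move=> ug0 lg0.
have [V [oV Voo EV]] := locally_Lp_cover hB hsep lg0 bE ug0.1.
pose K := [set g | wug u g /\ locally_Lp mu p E g].
have Kmin g h : K g -> K h -> K (fun x => mine (g x) (h x)).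
  move=> [ug lg] [uh lh]; split; first exact: weak_upper_gradient_min.
  apply: (le_locally_Lp _ ug.1) => //; first exact: nonneg_borel_min ug.1 uh.1.
  by move=> x _; rewrite ge_min lexx.
pose I n := ereal_inf [set energy mu p (E `&` V n) g | g in K].
have I0 n : 0 <= I n by apply: le_ereal_inf_tmp => _ [g _ <-]; exact: energy_ge0.
have Ile n g : K g -> I n <= energy mu p (E `&` V n) g.
  by move=> Kg; apply: ereal_inf_lbound; exists g.
have Ifin n : I n \is a fin_num.
  by rewrite ge0_fin_numE// (le_lt_trans _ (Voo n))// Ile.
have hG (nk : nat * nat) : exists g, K g /\
    energy mu p (E `&` V nk.1) g < I nk.1 + (nk.2.+1%:R^-1 : R)%:E.
  have k0 : (0 < nk.2.+1%:R^-1 :> R)%R by rewrite invr_gt0.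
  by have [_ [g Kg <-] lt] := lb_ereal_inf_adherent k0 (Ifin nk.1); exists g.
have [G hG'] := choice hG.
pose Gi i := if unpickle i is Some nk then G nk else g0.
have KGi i : K (Gi i) by rewrite /Gi; case: unpickle => // nk; exact: (hG' nk).1.
pose m := fix m j := if j is j'.+1 then (fun x => mine (m j' x) (Gi j' x)) else g0.
have Km j : K (m j) by elim: j => //= j IH; exact: Kmin.
pose g x := ereal_inf (range (m^~ x)).
have gm n x : g x <= m n x by apply: ereal_inf_lbound; exists n.
have ug : wug u g.
  apply: weak_upper_gradient_inf => //; first by move=> n; exact: (Km n).1.
  by move=> n x; rewrite /= ge_min lexx.
have lg : locally_Lp mu p E g by apply: (le_locally_Lp ug.1 ug0.1) => // x _; exact: (gm 0%N).
exists g; split => // h uh lh.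
have Kgh : K (fun x => mine (g x) (h x)) by exact: Kmin.
have bV n : borel (E `&` V n) by apply: measurableI => //; exact: open_borel.
have sV n : E `&` V n `<=` E by move=> y [].
have ae n : {ae (mu : set M -> \bar R), forall x, (E `&` V n) x -> g x <= mine (g x) (h x)}.
  have gV : nonneg_borel (E `&` V n) g by exact: nonneg_borelS ug.1.
  have gI : energy mu p (E `&` V n) g <= I n.
    apply/lee_addgt0Pr => e e0.
    have [k ke] : exists k : nat, (k.+1%:R^-1 < e)%R.
      exists (Num.truncn e^-1); rewrite invf_plt ?posrE// ?ltr0n//.
      exact: truncnS_gt.
    apply: (@le_trans _ _ (energy mu p (E `&` V n) (G (n, k)))).
      apply: le_energy => //; first by apply: nonneg_borelS (hG' (n, k)).1.1.1.
      move=> x _; apply: le_trans (gm (pickle (n, k)).+1 x) _.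
      by rewrite /= /Gi pickleK ge_min lexx orbT.
    by rewrite (le_trans (ltW (hG' (n, k)).2))// leeD2l// lee_fin ltW.
  apply: (ae_le_of_energy hB p0 (bV n)) => //.
  - by apply: nonneg_borelS Kgh.1.1.
  - by move=> x _; rewrite ge_min lexx.
  - exact: le_trans gI (Ile n _ Kgh).
  - by apply: (le_lt_trans gI); rewrite (le_lt_trans _ (Voo n))// Ile.
apply: ae_carS (ae_car_all ae) => x hx Ex; have [n _ Vn] := EV x Ex.
by apply: le_trans (hx n (conj Ex Vn)) _; rewrite ge_min lexx orbT.
Qed.

End minimal_gradient.

Section energy_sum.
Context {R : realType} {X : pmetricType R}.
Local Open Scope ereal_scope.
Variable mu : {outer_measure set X -> \bar R}.
Hypothesis hB : forall B : set X, borel B -> mu.-caratheodory B.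
Variable p : R.
Hypothesis p0 : (0 < p)%R.
Implicit Types (E : set X) (g h : X -> \bar R).

Lemma le_poweR (x y : \bar R) (r : R) : (0 <= r)%R -> 0 <= x -> x <= y ->
  x `^ r <= y `^ r.
Proof.
move=> r0 x0 xy; apply: gt0_ler_poweR => //; rewrite in_itv/= leey andbT//.
exact: le_trans xy.
Qed.

(** If y <= t x the sum is at most (1 + t) x, otherwise at most (1 + 1 / t) y. As t tends to 0 the
    factor of the first term tends to 1, and the second term can be made small when y is. *)
Lemma poweRD_le (x y : \bar R) (t : R) : 0 <= x -> 0 <= y -> (0 < t)%R ->
  (x + y) `^ p <=
  ((1 + t) `^ p)%:E * x `^ p + ((1 + t^-1) `^ p)%:E * y `^ p.
Proof.
move=> x0 y0 t0; have t10 : (0 < t^-1)%R by rewrite invr_gt0.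
have p00 := ltW p0.
have [yx|xy] := leP y (t%:E * x).
  apply: (@le_trans _ _ (((1 + t)%:E * x) `^ p)).
    apply: le_poweR => //; first exact: adde_ge0.
    by rewrite EFinD ge0_muleDl ?lee_fin ?(ltW t0)// mul1e leeD2l.
  rewrite poweRM ?lee_fin ?addr_ge0 ?(ltW t0)// poweR_EFin leeDl//.
  by rewrite mule_ge0 ?poweR_ge0// lee_fin powR_ge0.
apply: (@le_trans _ _ (((1 + t^-1)%:E * y) `^ p)).
  apply: le_poweR => //; first exact: adde_ge0.
  rewrite EFinD ge0_muleDl ?lee_fin ?(ltW t10)// mul1e addeC leeD2l//.
  by rewrite lee_pdivlMl// ltW.
rewrite poweRM ?lee_fin ?addr_ge0 ?(ltW t10)// poweR_EFin leeDr//.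
by rewrite mule_ge0 ?poweR_ge0// lee_fin powR_ge0.
Qed.

Lemma energyD_le E g h (t : R) : borel E -> nonneg_borel E g ->
  nonneg_borel E h -> (0 < t)%R ->
  energy mu p E (fun x => g x + h x) <=
  ((1 + t) `^ p)%:E * energy mu p E g + ((1 + t^-1) `^ p)%:E * energy mu p E h.
Proof.
move=> bE gE hE t0.
have mE : measurable (E : set (caratheodory_type mu)) by exact: hB.
have mg := measurable_energy hB p bE gE.1.
have mh := measurable_energy hB p bE hE.1.
rewrite /energy -!ge0_integralZl//; try by move=> x _; exact: poweR_ge0.
- rewrite -ge0_integralD//.
  + apply: ge0_le_integral => //.
    * by move=> x _; exact: poweR_ge0.
    * exact: measurable_energy (nonneg_borelD gE hE).1.
    * by apply: emeasurable_funD; exact: measurable_funeM.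
    * by move=> x Ex; apply: poweRD_le => //; [exact: gE.2|exact: hE.2].
  + by move=> x _; rewrite mule_ge0 ?poweR_ge0// lee_fin powR_ge0.
  + exact: measurable_funeM.
  + by move=> x _; rewrite mule_ge0 ?poweR_ge0// lee_fin powR_ge0.
  + exact: measurable_funeM.
- by rewrite lee_fin powR_ge0.
- by rewrite lee_fin powR_ge0.
Qed.

Lemma energyD_lty E g h : borel E -> nonneg_borel E g -> nonneg_borel E h ->
  energy mu p E g < +oo -> energy mu p E h < +oo ->
  energy mu p E (fun x => g x + h x) < +oo.
Proof.
move=> bE gE hE goo hoo; apply: le_lt_trans (energyD_le bE gE hE ltr01) _.
by rewrite lte_add_pinfty// lte_mul_pinfty// ?lee_fin ?powR_ge0.
Qed.

Lemma locally_LpD E g h : borel E -> nonneg_borel E g -> nonneg_borel E h ->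
  locally_Lp mu p E g -> locally_Lp mu p E h ->
  locally_Lp mu p E (fun x => g x + h x).
Proof.
move=> bE gE hE lg lh x Ex.
have [V [oV Vx Voo]] := lg x Ex; have [W [oW Wx Woo]] := lh x Ex.
have bV : borel (E `&` V) by apply: measurableI => //; exact: open_borel.
have bW : borel (E `&` W) by apply: measurableI => //; exact: open_borel.
have bVW : borel (E `&` (V `&` W)).
  by apply: measurableI => //; apply: open_borel; exact: openI.
exists (V `&` W); split; [exact: openI|by []|].
have sV : E `&` (V `&` W) `<=` E `&` V by move=> y [? []].
have sW : E `&` (V `&` W) `<=` E `&` W by move=> y [? []].
apply: energyD_lty => //.
- by apply: nonneg_borelS gE => // y [].
- by apply: nonneg_borelS hE => // y [].
- apply: le_lt_trans Voo; apply: energyS => //.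
  by apply: nonneg_borelS gE => // y [].
- apply: le_lt_trans Woo; apply: energyS => //.
  by apply: nonneg_borelS hE => // y [].
Qed.

Lemma locally_LpZ E g (k : R) : borel E -> nonneg_borel E g -> (0 <= k)%R ->
  locally_Lp mu p E g -> locally_Lp mu p E (fun x => k%:E * g x).
Proof.
move=> bE gE k0 lg x Ex; have [V [oV Vx Voo]] := lg x Ex; exists V; split => //.
have bV : borel (E `&` V) by apply: measurableI => //; exact: open_borel.
rewrite energyZ//; last by apply: nonneg_borelS gE => // y [].
by rewrite lte_mul_pinfty// lee_fin powR_ge0.
Qed.

Lemma energy_lty_locally_Lp E g : borel E -> nonneg_borel E g ->
  energy mu p E g < +oo -> locally_Lp mu p E g.
Proof.
by move=> bE gE goo x Ex; exists setT; split => //; [exact: openT|rewrite setIT].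
Qed.

End energy_sum.

(** * Lipschitz combinations, restriction and extension by zero *)

Section calculus_of_gradients.
Context {R : realType} {X : pmetricType R}.
Local Open Scope ereal_scope.
Variable mu : {outer_measure set X -> \bar R}.
Hypothesis hB : forall B : set X, borel B -> mu.-caratheodory B.
Hypothesis hsep : separable_space X.
Variable p : R.
Hypothesis p0 : (0 < p)%R.
Implicit Types (E : set X) (u v w : X -> R) (g h rho : X -> \bar R) (c : curve X).
Local Notation M := (caratheodory_type mu).

Lemma continuous_borel_fun u : continuous u ->
  measurable_fun [set: borel_type X] (u : borel_type X -> R).
Proof.
move=> cu; apply: (measurability _ (RGenOpens.measurableE R)) => _ [_ [a [b ->]] <-].
rewrite setTI; apply: open_borel; apply: open_comp => [x _|]; first exact: cu.
exact: interval_open.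
Qed.

Lemma continuous_mu_measurable u : continuous u -> mu_measurable_fun mu setT u.
Proof.
move=> cu _ Y mY; rewrite setTI; apply: hB.
by rewrite -[X in borel X]setTI; exact: continuous_borel_fun.
Qed.

Lemma weak_upper_gradient_lipschitz2 E u v w g h : borel E ->
  (forall x y, (`|w x - w y| <= `|u x - u y| + `|v x - v y|)%R) ->
  weak_upper_gradient mu p E u g -> weak_upper_gradient mu p E v h ->
  weak_upper_gradient mu p E w (fun x => g x + h x).
Proof.
move=> bE wuv /(weak_upper_gradientP hB p0 _ _ bE)[gE ag].
move=> /(weak_upper_gradientP hB p0 _ _ bE)[hE ah].
apply/(weak_upper_gradientP hB p0 _ _ bE); split; first exact: nonneg_borelD.
apply: (ae_curveW _ (ae_curve_and hB p0 bE ag ah)) => c rc cE [cg ch].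
rewrite /upper_gradient_along (line_integralD bE rc cE gE hE).
apply: le_trans (leeD cg ch); rewrite -EFinD lee_fin; exact: wuv.
Qed.

Lemma weak_upper_gradient_lipschitz E u w g (k : R) : borel E -> (0 <= k)%R ->
  (forall x y, (`|w x - w y| <= k * `|u x - u y|)%R) ->
  weak_upper_gradient mu p E u g ->
  weak_upper_gradient mu p E w (fun x => k%:E * g x).
Proof.
move=> bE k0 wu /(weak_upper_gradientP hB p0 _ _ bE)[gE ag].
apply/(weak_upper_gradientP hB p0 _ _ bE); split; first exact: nonneg_borelZ.
apply: (ae_curveW _ ag) => c rc cE cg.
rewrite /upper_gradient_along (line_integralZ bE)//.
by rewrite (le_trans _ (lee_wpmul2l _ cg))// -EFinM lee_fin.
Qed.

Lemma upper_gradient_cst E u (k : R) : (0 <= k)%R ->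
  (forall x y, (`|u x - u y| <= k * mdist x y)%R) ->
  upper_gradient E u (cst k%:E).
Proof.
move=> k0 uk; split; first exact: nonneg_borel_cst.
move=> c rc cE; rewrite /upper_gradient_along line_integral_cst//.
apply: (@le_trans _ _ (k%:E * (mdist (c (cstart c)) (c (cend c)))%:E)).
  by rewrite -EFinM lee_fin.
by rewrite lee_wpmul2l// mdist_path_length// curve_le.
Qed.

Lemma weak_upper_gradientS E E' u g : borel E -> borel E' -> E' `<=` E ->
  weak_upper_gradient mu p E u g -> weak_upper_gradient mu p E' u g.
Proof.
move=> bE bE' EE /(weak_upper_gradientP hB p0 _ _ bE)[gE [rho [rE roo h]]].
apply/(weak_upper_gradientP hB p0 _ _ bE'); split; first exact: nonneg_borelS gE.
exists rho; split; first exact: nonneg_borelS rE.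
  exact: le_lt_trans (energyS hB p bE bE' EE rE) roo.
by move=> c rc cE; apply: h => // t tc; exact/EE/cE.
Qed.

Lemma arcline_clamp c (s : R) : rectifiable c ->
  arcline c s = arcline c (Num.max 0 (Num.min s (fine (curve_length c))))%R.
Proof.
move=> rc; rewrite /arcline; congr arclength; have := curve_length_ge0 c.
by rewrite /Num.max /Num.min; do 4! case: ifPn; lra.
Qed.

(** The set where [w] does not vanish need not be Borel, hence the larger [B]. On almost every curve
    [g] is integrable, which makes [w] continuous along it, and [increments_off_zeros] applies. *)
Lemma weak_upper_gradient_off_zeros E w g (B : set X) : borel E -> borel B ->
  weak_upper_gradient mu p E w g -> locally_Lp mu p E g ->
  (forall x, E x -> w x <> 0%R -> B x) ->
  weak_upper_gradient mu p E w (g \_ B).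
Proof.
move=> bE bB /(weak_upper_gradientP hB p0 _ _ bE)[gE ag] lg wB.
have gBE := nonneg_borel_restrictS bE bB gE.
apply/(weak_upper_gradientP hB p0 _ _ bE); split => //.
have [rho [rE roo hrho]] :=
  ae_curve_and hB p0 bE ag (ae_curve_locally_Lp hB hsep p0 bE gE lg).
exists rho; split => // c rc cE cr.
have Fg : increments_bounded (w \o arcline c) (g \o arcline c) (fine (curve_length c)).
  by apply: (increments_bounded_arcline bE rE) => // c' rc' c'E c'r; have [] := hrho c' rc' c'E c'r.
have mg := arcline_measurable_fun bE rc cE gE.
have g0 := arcline_fun_ge0 rc cE gE.
have L0 := curve_length_ge0 c.
have goo := (hrho c rc cE cr).2.
apply/upper_gradient_along_arcline => //.
apply: (@increments_off_zeros _ (w \o arcline c) (g \o arcline c) (g \_ B \o arcline c)) => //.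
- apply: (increments_continuous L0 mg g0 _ Fg).
    by move=> s; rewrite /= -arcline_clamp.
  by move: goo; rewrite line_integralE.
- exact: arcline_measurable_fun gBE.
- exact: (arcline_fun_ge0 rc cE gBE).
- move=> x _ wx; rewrite /= patchE mem_set//; apply: wB => //; exact: arcline_in.
- by move=> s t s0 st tL _; apply: Fg => //; exact: ltW.
Qed.

(* An upper gradient on U of a function supported in U extends by zero: the
   parts of a curve before the first and after the last zero of u stay in U. *)
Lemma upper_gradient_along_extend (U : set X) u h rho : open U ->
  continuous u -> supp u `<=` U -> nonneg_borel U h -> nonneg_borel U rho ->
  (forall c, rectifiable c -> curve_in U c -> line_integral c rho < +oo ->
     upper_gradient_along u h c) ->
  forall c, rectifiable c -> line_integral c (rho \_ U) < +oo ->
  upper_gradient_along u (h \_ (supp u)) c.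
Proof.
move=> oU cu uU hU rU H c rc cr.
have bU := open_borel oU.
have bS : borel (supp u) by apply: closed_borel; exact: closed_closure.
have bT : borel [set: X] by exact: measurableT.
have cT : curve_in setT c by [].
have hUT := nonneg_borel_restrict bU hU; have rUT := nonneg_borel_restrict bU rU.
have hST : nonneg_borel setT (h \_ (supp u)).
  by apply: nonneg_borel_restrict => //; exact: nonneg_borelS hU.
have cF : continuous (u \o arcline c).
  by move=> s; apply: continuous_comp; [exact: arcline_continuous|exact: cu].
apply/upper_gradient_along_arcline => //.
apply: (@increments_off_zeros _ (u \o arcline c) (h \_ U \o arcline c) (h \_ (supp u) \o arcline c)) => //.
- exact: curve_length_ge0.
- exact: arcline_measurable_fun hUT.
- exact: (arcline_fun_ge0 rc cT hUT).
- exact: arcline_measurable_fun hST.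
- exact: (arcline_fun_ge0 rc cT hST).
- move=> x _ ux; have Sx : supp u (arcline c x) by apply: subset_closure; exact/eqP.
  by rewrite /= !patchE !mem_set//; exact: uU.
- move=> s t s0 st tL F0.
  (* The end points s and t are included because the support is closed: they are limits of
     parameters at which [u] does not vanish. *)
  have inS z : (s <= z <= t)%R -> supp u (arcline c z).
    move=> szt N NN; have := arcline_continuous rc NN.
    move=> /nbhs_ballP[d /= d0 hd].
    have [r [sr zr]] : exists r, (s < r < t)%R /\ (`|z - r| < d)%R.
      case/andP: szt => sz zt.
      have [zm|mz] := leP z ((s + t) / 2)%R.
        exists (Num.min (z + d / 2) ((s + 3 * t) / 4))%R.
        by rewrite /Num.min; case: ifPn => ?; split; rewrite ?ltr_norml; apply/andP; split; lra.
      exists (Num.max (z - d / 2) ((3 * s + t) / 4))%R.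
      by rewrite /Num.max; case: ifPn => ?; split; rewrite ?ltr_norml; apply/andP; split; lra.
    by exists (arcline c r); split; [exact/eqP/F0|exact: hd].
  have [c' [rc' c's c't c'in c'int]] := exists_subcurve rc s0 (ltW st) tL.
  have c'U : curve_in U c'.
    by move=> r rI; have [z zI ->] := c'in r rI; exact/uU/inS.
  have restr f : line_integral c' f = line_integral c' (f \_ U).
    rewrite !line_integralE//; apply: eq_integral => r _.
    by rewrite patchE mem_set//; exact: arcline_in.
  have mh := arcline_measurable_fun bT rc cT hUT.
  have mr := arcline_measurable_fun bT rc cT rUT.
  rewrite /= -c's -c't -(c'int _ mh (arcline_fun_ge0 rc cT hUT)) -restr; apply: H => //.
  rewrite restr (c'int _ mr (arcline_fun_ge0 rc cT rUT)).
  apply: le_lt_trans cr; rewrite line_integralE//.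
  apply: ge0_subset_integral => //; first exact: measurable_funTS.
    by move=> r _; exact: (arcline_fun_ge0 rc cT rUT).
  by move=> z /=; rewrite !in_itv/= => /andP[sz zt]; rewrite (le_trans s0)// (le_trans zt).
Qed.

Lemma weak_upper_gradient_extend (U : set X) u h : open U -> continuous u ->
  supp u `<=` U -> weak_upper_gradient mu p U u h ->
  weak_upper_gradient mu p setT u (h \_ (supp u)).
Proof.
move=> oU cu uU; have bU := open_borel oU.
have bS : borel (supp u) by apply: closed_borel; exact: closed_closure.
have bT : borel [set: X] by exact: measurableT.
move=> /(weak_upper_gradientP hB p0 _ _ bU)[hU [rho [rU roo H]]].
apply/(weak_upper_gradientP hB p0 _ _ bT); split.
  by apply: nonneg_borel_restrict => //; exact: nonneg_borelS hU.
exists (rho \_ U); split; first exact: nonneg_borel_restrict.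
  by rewrite energy_restrict// setTI.
move=> c rc _ cr; exact: (upper_gradient_along_extend oU cu uU hU rU H rc cr).
Qed.

Lemma dirichlet_extend (U : set X) u : open U -> continuous u ->
  supp u `<=` U -> dirichlet mu p U u -> dirichlet mu p setT u.
Proof.
move=> oU cu uU [_ [h [hU H] hoo]]; have bU := open_borel oU.
have bS : borel (supp u) by apply: closed_borel; exact: closed_closure.
have bT : borel [set: X] by exact: measurableT.
split.
  exact: continuous_mu_measurable.
exists (h \_ (supp u)).
  split; first by apply: nonneg_borel_restrict => //; exact: nonneg_borelS hU.
  (* An upper gradient has no exceptional curves, so the zero function is a valid [rho]. *)
  move=> c rc _; apply: (upper_gradient_along_extend oU cu uU hU (nonneg_borel_cst U (lexx 0))) => //.
    by move=> c' rc' c'U _; exact: H.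
  by rewrite line_integralE// integral0_eq// => r _; rewrite patchE; case: ifPn.
rewrite energy_restrict// setTI; apply: le_lt_trans hoo; exact: energyS.
Qed.

End calculus_of_gradients.

(** * Lipschitz functions and locality *)

Section lipschitz.
Context {R : realType} {X : pmetricType R}.
Implicit Types (u v : X -> R).

Lemma Lip_gt0 u : Lip u -> exists2 K : R, 0 < K &
  forall x y, `|u x - u y| <= K * mdist x y.
Proof.
move=> [L uL]; exists (`|L| + 1); first by rewrite ltr_wpDl.
move=> x y; apply: le_trans (uL x y) _; rewrite ler_wpM2r ?mdist_ge0//.
by rewrite (le_trans (ler_norm L))// lerDl.
Qed.

Lemma Lip_continuous u : Lip u -> continuous u.
Proof.
move=> /Lip_gt0[K K0 uK] x A /nbhs_ballP[e /= e0 eA].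
apply/nbhs_ballP; exists (e / K); first by rewrite /= divr_gt0.
move=> y; rewrite ballEmdist/= => xy; apply: eA; rewrite /ball/=.
by apply: le_lt_trans (uK x y) _; rewrite mulrC -ltr_pdivlMr.
Qed.

Lemma LipZ u (k : R) : Lip u -> Lip (fun x => k * u x).
Proof.
move=> [L uL]; exists (`|k| * L) => x y.
by rewrite -mulrBr normrM -mulrA ler_wpM2l.
Qed.

Lemma mdist_lip (x y z : X) : `|mdist x y - mdist x z| <= mdist y z.
Proof.
rewrite ler_norml; apply/andP; split.
  by have := metric_triangle x y z; lra.
by have := metric_triangle x z y; rewrite (metric_sym z y); lra.
Qed.

Lemma closed_mdist_ge (x : X) (r : R) : closed [set y | r <= mdist x y].
Proof.
have -> : [set y | r <= mdist x y] = ~` ball x r.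
  apply/seteqP; split => y; rewrite ballEmdist/= leNgt; first by move/negP.
  by move=> h; apply/negP.
exact/open_closedC/open_mball.
Qed.

Lemma closed_mdist_le (x : X) (r : R) : closed [set y | mdist x y <= r].
Proof.
rewrite -(setCK [set y | _]); apply: open_closedC; rewrite openE => y /= /negP.
rewrite -ltNge => ry; apply/nbhs_ballP; exists (mdist x y - r).
  by rewrite /= subr_gt0.
move=> z; rewrite ballEmdist/= => yz; apply/negP; rewrite -ltNge.
by have := metric_triangle x z y; rewrite (metric_sym z y); lra.
Qed.

End lipschitz.

Section metric_measure_gradients.
Context {R : realType} {X : pmetricType R}.
Local Open Scope ereal_scope.
Variable mu : {outer_measure set X -> \bar R}.
Hypothesis hM : metric_measure_space mu.
Let hB := mms_borel hM.
Let hsep := mms_separable hM.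
Variable p : R.
Hypothesis p0 : (0 < p)%R.
Implicit Types (U E : set X) (u v w : X -> R) (g h : X -> \bar R).
Local Notation M := (caratheodory_type mu).

Lemma mball_finite (x : X) (r : R) : mu (ball x r) < +oo.
Proof. by apply: (mms_finite hM); exists x, r. Qed.

Lemma energy_cst E (k : R) : borel E -> (0 <= k)%R ->
  energy mu p E (cst k%:E) = (k `^ p)%:E * mu E.
Proof.
move=> bE k0; rewrite /energy/= -poweR_EFin integral_cst//; exact: hB.
Qed.

Lemma locally_Lp_cst (k : R) : (0 <= k)%R -> locally_Lp mu p setT (cst k%:E).
Proof.
move=> k0 x _; exists (ball x 1%R); split.
- exact: open_mball.
- exact: ballxx.
- rewrite setTI energy_cst//; last by apply: open_borel; exact: open_mball.
  by rewrite lte_mul_pinfty ?lee_fin ?powR_ge0// mball_finite.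
Qed.

Lemma minimal_gradP E u g : borel E -> weak_upper_gradient mu p E u g ->
  locally_Lp mu p E g -> minimal_weak_upper_gradient mu p E u (grad mu p E u).
Proof.
move=> bE ug lg; have [g' mg'] := minimal_weak_upper_gradient_exists hB hsep p0 bE ug lg.
by apply: (@xgetPex _ (cst +oo) [set g | minimal_weak_upper_gradient mu p E u g]); exists g'.
Qed.

Lemma Lip_grad u : Lip u ->
  minimal_weak_upper_gradient mu p setT u (grad mu p setT u).
Proof.
move=> /Lip_gt0[K K0 uK]; have bT : borel [set: X] by exact: measurableT.
apply: (@minimal_gradP setT u (cst K%:E)) => //.
  apply: upper_gradient_weak => //.
  by apply: upper_gradient_cst => //; exact: ltW.
by apply: locally_Lp_cst; exact: ltW.
Qed.

Lemma dirichlet_grad U u : borel U -> dirichlet mu p U u ->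
  minimal_weak_upper_gradient mu p U u (grad mu p U u) /\
  energy mu p U (grad mu p U u) < +oo.
Proof.
move=> bU [_ [g ug goo]]; have wg := upper_gradient_weak hB p0 bU ug.
have lg : locally_Lp mu p U g by apply: energy_lty_locally_Lp => //; case: ug.
have mg := minimal_gradP bU wg lg; split => //.
have [wgr _ min] := mg; apply: le_lt_trans goo.
by apply: ae_le_energy => //; [exact: wgr.1|exact: wg.1|exact: min].
Qed.

(** A Borel hull of equal measure differs by a null set only when that measure is finite; [S] is
    therefore cut by the balls of radius n + 1, which have finite measure. *)
Lemma borel_hull (S : set X) : mu.-caratheodory S ->
  exists B : set X, [/\ borel B, S `<=` B & mu (B `\` S) = 0].
Proof.
move=> mS; pose A n := S `&` ball (point : X) (n.+1%:R : R).
have mA n : measurable (A n : set M).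
  by apply: measurableI => //; apply: hB; apply: open_borel; exact: open_mball.
have Aoo n : mu (A n) < +oo.
  by apply: le_lt_trans (mball_finite point n.+1%:R); apply: le_outer_measure => x [].
have hull n : exists B, [/\ borel B, A n `<=` B & mu (B `\` A n) = 0].
  have [B bB [AB muAB]] := mms_regular hM (A n); exists B; split => //.
  have Boo : mu B < +oo by rewrite -muAB.
  have mB : measurable (B : set M) by exact: hB.
  have -> : mu (B `\` A n) = mu B - mu (B `&` A n).
    exact: (@measureD _ M _ (mu : {measure set M -> \bar R}) _ _ mB (mA n) Boo).
  rewrite setIidr// muAB subee// ge0_fin_numE//; exact: outer_measure_ge0.
have [B h] := choice hull.
exists (\bigcup_n B n); split.
- by apply: bigcupT_measurable => n; have [] := h n.
- move=> x Sx; exists (Num.truncn (mdist point x)) => //.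
  have [_ + _] := h (Num.truncn (mdist point x)); apply; split => //.
  by rewrite ballEmdist/=; exact: truncnS_gt.
- apply/eqP; rewrite eq_le outer_measure_ge0 andbT.
  have sub : (\bigcup_n B n) `\` S `<=` \bigcup_n (B n `\` A n).
    by move=> x [[n _ Bx] nS]; exists n => //; split => // -[].
  apply: (le_trans (le_outer_measure mu _ _ sub)).
  apply: (le_trans (outer_measure_sigma_subadditive mu _)).
  by rewrite eseries0// => n _ _; have [] := h n.
Qed.

(* If w = u - v vanishes on A, then w has a weak upper gradient vanishing
   almost everywhere on A. *)
Lemma minimal_le_on_eq u v g h : minimal_weak_upper_gradient mu p setT u g ->
  weak_upper_gradient mu p setT v h -> locally_Lp mu p setT h ->
  mu_measurable_fun mu setT u -> mu_measurable_fun mu setT v ->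
  {ae (mu : set M -> \bar R), forall x, u x = v x -> g x <= h x}.
Proof.
move=> [ug lg ming] vh lh mu_ mv; have bT : borel [set: X] by exact: measurableT.
pose S := [set x | u x <> v x].
have mS : mu.-caratheodory S.
  have -> : S = ~` ([set: X] `&` (fun x => (u x - v x)%R) @^-1` [set 0%R]).
    rewrite setTI; apply/seteqP; split => x /= h1 h2; apply: h1.
      by apply/eqP; rewrite -subr_eq0 h2.
    by rewrite h2 subrr.
  apply: (@measurableC _ M); apply: (measurable_funB mu_ mv) => //.
have [B [bB SB BS0]] := borel_hull mS.
pose d x := g x + h x.
have wd : weak_upper_gradient mu p setT (fun x => (u x - v x)%R) d.
  apply: (weak_upper_gradient_lipschitz2 hB p0 bT _ ug vh) => x y.
  rewrite (_ : u x - v x - (u y - v y) = (u x - u y) - (v x - v y))%R ?ler_normB//.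
  by lra.
have ld : locally_Lp mu p setT d by apply: locally_LpD => //; [exact: ug.1|exact: vh.1].
have wdB : weak_upper_gradient mu p setT (fun x => (u x - v x)%R) (d \_ B).
  apply: (weak_upper_gradient_off_zeros hB hsep p0 bT bB wd ld) => x _ uv.
  by apply: SB => /= e; apply: uv; rewrite e subrr.
have dB0 : nonneg_borel setT (d \_ B) by exact: wdB.1.
have ldB : locally_Lp mu p setT (d \_ B).
  apply: (le_locally_Lp hB p0 bT _ wd.1 _ ld) => // x _.
  by rewrite patchE; case: ifPn => // _; exact: wd.1.2.
(* Writing u = v + (u - v) produces a competitor for [g] that equals [h] almost everywhere on the
   set where u = v. *)
have wu : weak_upper_gradient mu p setT u (fun x => h x + (d \_ B) x).
  apply: (weak_upper_gradient_lipschitz2 hB p0 bT _ vh wdB) => x y.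
  rewrite (_ : u x - u y = (v x - v y) + ((u x - v x) - (u y - v y)))%R ?ler_normD//.
  by rewrite opprB; lra.
have lu := locally_LpD hB p0 bT vh.1 dB0 lh ldB.
have := ming _ wu lu.
have aeBS : {ae (mu : set M -> \bar R), forall x, ~ (B `\` S) x}.
  by apply/(aeP mu); rewrite -BS0; congr (mu _); apply/seteqP; split => x /=; [move/contrapT|move=> h1 h2; exact: h2].
move=> /(ae_car_and aeBS); apply: ae_carS => x [nBS /(_ I)] le uvx.
apply: le_trans le _; rewrite patchE; case: ifPn => [/set_mem Bx|_]; last by rewrite adde0.
by exfalso; apply: nBS; split => //=.
Qed.

(** The map s x + c is an isometry of the line with inverse s (x - c), so composing with either
    keeps weak upper gradients, and [minimal_le_on_eq] applies in both directions. *)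
Lemma minimal_eq_on_affine u v g h (s c : R) :
  minimal_weak_upper_gradient mu p setT u g ->
  minimal_weak_upper_gradient mu p setT v h ->
  mu_measurable_fun mu setT u -> mu_measurable_fun mu setT v -> `|s|%R = 1%R ->
  {ae (mu : set M -> \bar R), forall x, u x = (s * v x + c)%R -> g x = h x}.
Proof.
move=> mg mh mu_ mv s1; have bT : borel [set: X] by exact: measurableT.
have ss : (s * s = 1)%R.
  by rewrite -expr2 -(ger0_norm (sqr_ge0 s)) normrX s1 expr1n.
have wv : weak_upper_gradient mu p setT (fun x => s * v x + c)%R h.
  have [wh _ _] := mh.
  have := @weak_upper_gradient_lipschitz _ _ mu hB p p0 setT v (fun x => s * v x + c)%R h 1%R bT ler01 _ wh.
  rewrite (_ : (fun x => 1%:E * h x) = h); last by apply/funext => x; rewrite mul1e.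
  apply => x y; rewrite mul1r (_ : s * v x + c - (s * v y + c) = s * (v x - v y))%R; last by lra.
  by rewrite normrM s1 mul1r.
have wu : weak_upper_gradient mu p setT (fun x => s * (u x - c))%R g.
  have [wg _ _] := mg.
  have := @weak_upper_gradient_lipschitz _ _ mu hB p p0 setT u (fun x => s * (u x - c))%R g 1%R bT ler01 _ wg.
  rewrite (_ : (fun x => 1%:E * g x) = g); last by apply/funext => x; rewrite mul1e.
  apply => x y; rewrite mul1r (_ : s * (u x - c) - s * (u y - c) = s * (u x - u y))%R; last by lra.
  by rewrite normrM s1 mul1r.
have mv' : mu_measurable_fun mu setT (fun x => s * v x + c)%R.
  by apply: measurable_funD => //; apply: measurable_funM.
have mu' : mu_measurable_fun mu setT (fun x => s * (u x - c))%R.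
  by apply: measurable_funM => //; apply: measurable_funB.
have [_ lg _] := mg; have [_ lh _] := mh.
have h1 := minimal_le_on_eq mg wv lh mu_ mv'.
have h2 := minimal_le_on_eq mh wu lg mv mu'.
apply: ae_carS (ae_car_and h1 h2) => x [le1 le2] uv.
apply/eqP; rewrite eq_le le1//= le2// uv addrK mulrA ss mul1r//.
Qed.

Lemma grad_scale_le u v (k : R) :
  minimal_weak_upper_gradient mu p setT u (grad mu p setT u) ->
  minimal_weak_upper_gradient mu p setT v (grad mu p setT v) ->
  (0 <= k)%R -> (forall x, v x = k * u x)%R ->
  {ae (mu : set M -> \bar R), forall x, grad mu p setT v x <= k%:E * grad mu p setT u x}.
Proof.
move=> [wu lu _] [_ _ minv] k0 vu; have bT : borel [set: X] by exact: measurableT.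
have wk : weak_upper_gradient mu p setT v (fun x => k%:E * grad mu p setT u x).
  apply: (weak_upper_gradient_lipschitz hB p0 bT k0 _ wu) => x y.
  by rewrite !vu -mulrBr normrM (ger0_norm k0).
have := minv _ wk (locally_LpZ hB bT wu.1 k0 lu).
by apply: ae_carS => x; exact.
Qed.

End metric_measure_gradients.

Lemma clamp_lipschitz (R : realType) (x y a b : R) : 0 <= a -> 0 <= b ->
  `|Num.max (- a) (Num.min x a) - Num.max (- b) (Num.min y b)| <=
  `|x - y| + `|a - b|.
Proof.
move=> a0 b0.
have := ler_norm (x - y); have := ler_norm (y - x).
have := ler_norm (a - b); have := ler_norm (b - a).
rewrite (distrC b) (distrC y) => h1 h2 h3 h4; rewrite ler_norml.
rewrite /Num.min; case: ifPn => ?; case: ifPn => ?;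
  rewrite /Num.max; case: ifPn => ?; case: ifPn => ?; apply/andP; split; lra.
Qed.

(** * Cutoff functions and the sawtooth *)

Section cutoffs.
Context {R : realType} {X : pmetricType R}.
Local Open Scope ereal_scope.
Variable mu : {outer_measure set X -> \bar R}.
Hypothesis hM : metric_measure_space mu.
Variable p : R.
Hypothesis p0 : (0 < p)%R.
Implicit Types (u v : X -> R).
Let hB := mms_borel hM.

Lemma supp_sub u (A : set X) : closed A -> (forall x, u x <> 0%R -> A x) ->
  supp u `<=` A.
Proof.
move=> cA uA; rewrite [X in _ `<=` X](closure_id A).1//.
by apply: closure_subset => x /= /eqP; exact: uA.
Qed.

Lemma Lip_dirichlet (U : set X) v : open U -> mu U < +oo -> Lip v ->
  dirichlet mu p U v.
Proof.
move=> oU Uoo /[dup] vL /Lip_gt0[K K0 vK]; have bU := open_borel oU.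
split.
  by apply: measurable_funS (continuous_mu_measurable hB (Lip_continuous vL)).
exists (cst K%:E); first by apply: upper_gradient_cst => //; exact: ltW.
rewrite energy_cst//; last exact: ltW.
by rewrite lte_mul_pinfty ?lee_fin ?powR_ge0.
Qed.

(** Clamp [u] between [-psi] and [psi], where the cone [psi] vanishes beyond radius r + 1 and is at
    least m on the ball of radius r; the Lipschitz bound gives |u| <= m there. Bounded support makes
    the energy finite. *)
Lemma bounded_cutoff u (y0 : X) (r : R) : Lip u -> (0 <= r)%R -> exists v,
  [/\ Lip v, dirichlet mu p setT v & forall y, ball y0 r y -> v y = u y].
Proof.
move=> /Lip_gt0[K K0 uK] r0.
pose m := (`|u y0| + K * r)%R.
have m0 : (0 <= m)%R by rewrite addr_ge0// mulr_ge0// ltW.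
pose psi y := Num.max 0%R (m * (r + 1 - mdist y0 y))%R.
pose v y := Num.max (- psi y)%R (Num.min (u y) (psi y)).
have psi0 y : (0 <= psi y)%R by rewrite /psi le_max lexx.
have psiL y z : (`|psi y - psi z| <= m * mdist y z)%R.
  have h : (`|m * (r + 1 - mdist y0 y) - m * (r + 1 - mdist y0 z)| <= m * mdist y z)%R.
    rewrite -mulrBr normrM (ger0_norm m0) ler_wpM2l//.
    rewrite (_ : r + 1 - mdist y0 y - (r + 1 - mdist y0 z) = mdist y0 z - mdist y0 y)%R; last by lra.
    by rewrite distrC mdist_lip.
  have d0 : (0 <= m * mdist y z)%R by rewrite mulr_ge0// mdist_ge0.
  move: h; rewrite /psi; set a := (m * (r + 1 - mdist y0 y))%R; set b := (m * _)%R.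
  rewrite !ler_norml => /andP[h1 h2].
  by rewrite /Num.max; case: ifPn => ?; case: ifPn => ?; apply/andP; split; lra.
have vL : Lip v.
  exists (K + m)%R => y z; rewrite mulrDl.
  apply: (@le_trans _ _ (`|u y - u z| + `|psi y - psi z|)%R); last by rewrite lerD.
  exact: clamp_lipschitz.
have suppv : supp v `<=` ball y0 (r + 2)%R.
  apply: (@subset_trans _ [set y | mdist y0 y <= r + 1]%R).
    apply: supp_sub; first exact: closed_mdist_le.
    move=> y; apply: contra_notP => /= /negP; rewrite -ltNge => ry.
    have -> : v y = Num.max 0%R (Num.min (u y) 0%R).
      rewrite /v; have -> : psi y = 0%R; last by rewrite oppr0.
      rewrite /psi (max_idPl _)// mulr_ge0_le0//; lra.
    by rewrite (max_idPl _)// ge_min lexx orbT.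
  by move=> y /= yr; rewrite ballEmdist/=; lra.
exists v; split => //.
  apply: (dirichlet_extend hB p0 (open_mball y0 (r + 2)) (Lip_continuous vL) suppv).
  by apply: Lip_dirichlet => //; [exact: open_mball|exact: mball_finite].
move=> y; rewrite ballEmdist/= => yr.
have um : (`|u y| <= m)%R.
  have := uK y y0; rewrite (metric_sym y) => h.
  have h2 : (K * mdist y0 y <= K * r)%R by rewrite ler_wpM2l// ltW.
  have := ler_normD (u y - u y0)%R (u y0); rewrite subrK /m; lra.
have mpsi : (m <= psi y)%R.
  rewrite /psi le_max; apply/orP; right.
  by rewrite -{1}(mulr1 m) ler_wpM2l//; lra.
move: um; rewrite ler_norml => /andP[? ?].
by rewrite /v (min_idPl _) ?(max_idPr _)//; lra.
Qed.

(* The function is e times a Lipschitz cutoff, built from the distance to the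
   complement of U truncated at 2d. *)
Lemma interior_cutoff (U : set X) (d e : R) : (0 < d)%R -> (0 <= e)%R ->
  exists psi : X -> R, [/\ (forall x, 0 <= psi x <= e)%R,
    (forall x y, `|psi x - psi y| <= e / d * mdist x y)%R,
    (forall x, (forall z, ~ U z -> 2 * d <= mdist x z)%R -> psi x = e) &
    (forall x, psi x <> 0%R -> forall z, ~ U z -> d <= mdist x z)%R].
Proof.
move=> d0 e0.
(* The extra element 2 d truncates the distance and keeps the infimum meaningful when the complement
   of [U] is empty. *)
pose S x := [set (2 * d)%R] `|` [set mdist x z | z in ~` U].
pose D x := inf (S x).
have S2 x : S x (2 * d)%R by left.
have Slb x : has_lbound (S x).
  exists 0%R => _ [->|[z _ <-]]; last exact: mdist_ge0.
  by rewrite mulr_ge0// ltW.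
have hS x : has_inf (S x) by split => //; exists (2 * d)%R.
have D2 x : (D x <= 2 * d)%R by apply: ge_inf.
have Dz x z : ~ U z -> (D x <= mdist x z)%R by move=> nUz; apply: ge_inf => //; right; exists z.
have DL x y : (D x <= D y + mdist x y)%R.
  rewrite -lerBlDr; apply: lb_le_inf; first by exists (2 * d)%R.
  move=> _ [->|[z nUz <-]].
    by have := D2 x; have := mdist_ge0 x y; lra.
  by have := Dz x z nUz; have := metric_triangle x y z; lra.
have ed0 : (0 <= e / d)%R by rewrite divr_ge0// ltW.
exists (fun x => e / d * Num.max 0 (D x - d))%R; split.
- move=> x; apply/andP; split; first by rewrite mulr_ge0// le_max lexx.
  rewrite -[leRHS](divfK (lt0r_neq0 d0)) ler_wpM2l// ge_max ltW//=.
  by have := D2 x; lra.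
- move=> x y; rewrite -mulrBr normrM (ger0_norm ed0) ler_wpM2l//.
  have := DL x y; have := DL y x; rewrite (metric_sym y).
  have := mdist_ge0 x y; rewrite /Num.max ler_norml.
  by case: ifPn => ?; case: ifPn => ? *; apply/andP; split; lra.
- move=> x hx; have -> : D x = (2 * d)%R.
    apply/eqP; rewrite eq_le D2/=; apply: lb_le_inf; first by exists (2 * d)%R.
    by move=> _ [->//|[z nUz <-]]; exact: hx.
  by rewrite (max_idPr _); [rewrite (_ : 2 * d - d = d)%R ?divfK ?gt_eqF//; lra|lra].
- move=> x psix z nUz; have := Dz x z nUz.
  suff : (d < D x)%R by lra.
  rewrite ltNge; apply/negP => Dd; apply: psix.
  by rewrite (max_idPl _) ?mulr0//; lra.
Qed.

End cutoffs.

(** [f] is the distance to the lattice 2 e Z, and [k x] indexes a nearest lattice point. Its affine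
    branches, given by a lattice point and a sign, are enumerated by [nat] so that locality is used
    for countably many of them. *)
Lemma sawtooth (R : realType) (e : R) : 0 < e ->
  exists (f : R -> R) (s c : nat -> R),
  [/\ forall x y, `|f x - f y| <= `|x - y|, forall x, 0 <= f x <= e,
      forall i, `|s i| = 1 & forall x, exists i, f x = s i * x + c i].
Proof.
move=> e0; pose k (x : R) : int := Num.floor ((x + e) / (2 * e)).
have e20 : 0 < 2 * e by rewrite mulr_gt0.
pose f x := `|x - 2 * e * (k x)%:~R|.
have kx x : `|x - 2 * e * (k x)%:~R| <= e.
  have h1 : (k x)%:~R * (2 * e) <= x + e by rewrite -ler_pdivlMr// floor_le.
  have h2 : x + e < ((k x)%:~R + 1) * (2 * e).
    by have := floorD1_gt ((x + e) / (2 * e)); rewrite intrD ltr_pdivrMr.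
  by rewrite ler_norml; apply/andP; split; lra.
(* [f] is thus a minimum of 1-Lipschitz functions, hence 1-Lipschitz. *)
have fmin x (j : int) : f x <= `|x - 2 * e * j%:~R|.
  have [->//|jk] := eqVneq j (k x).
  apply: le_trans (kx x) _.
  have h : 1 <= `|(k x - j)%:~R : R|.
    by rewrite -intr_norm -[X in X <= _]/(1%:~R) ler_int -gtz0_ge1 normr_gt0 subr_eq0 eq_sym.
  have := ler_normB (x - 2 * e * j%:~R) (x - 2 * e * (k x)%:~R).
  rewrite (_ : x - 2 * e * j%:~R - (x - 2 * e * (k x)%:~R) = 2 * e * (k x - j)%:~R); last first.
    by rewrite intrB; lra.
  rewrite normrM (ger0_norm (ltW e20)) => h2.
  have : 2 * e <= 2 * e * `|(k x - j)%:~R| by rewrite ler_peMr// ltW.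
  by have := kx x; lra.
have fL x y : f x <= f y + `|x - y|.
  apply: le_trans (fmin x (k y)) _.
  rewrite (_ : x - 2 * e * (k y)%:~R = (y - 2 * e * (k y)%:~R) + (x - y)); last by lra.
  exact: ler_normD.
pose dec i : int * bool := odflt (0, true) (unpickle i).
exists f, (fun i => if (dec i).2 then 1 else -1),
  (fun i => (if (dec i).2 then -1 else 1) * (2 * e * ((dec i).1)%:~R)); split.
- move=> x y; have := fL x y; have := fL y x; rewrite (distrC y) => h1 h2.
  by rewrite ler_norml; apply/andP; split; lra.
- by move=> x; rewrite /f normr_ge0 kx.
- by move=> i; case: ifP => _; rewrite ?normrN normr1.
- move=> x; have [h|h] := leP 0 (x - 2 * e * (k x)%:~R).
    exists (pickle (k x, true)); rewrite /dec pickleK/= /f ger0_norm//; lra.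
  by exists (pickle (k x, false)); rewrite /dec pickleK/= /f ltr0_norm//; lra.
Qed.

(** * The composition operator *)

Section composition.
Context {R : realType} {X Y : pmetricType R}.
Local Open Scope ereal_scope.
Variables (mu : {outer_measure set X -> \bar R})
          (nu : {outer_measure set Y -> \bar R}).
Hypotheses (hX : metric_measure_space mu) (hY : metric_measure_space nu).
Variables (p q : R) (phi : X -> Y).
Hypotheses (p1 : (1 <= p)%R) (q0 : (0 < q)%R).
Hypothesis hphi : measurable_mapping mu phi.
Hypothesis hcomp : induces_bounded_composition mu nu p q phi.
Implicit Types (u v : Y -> R) (U B G : set Y) (g h : X -> \bar R).
Local Notation M := (caratheodory_type mu).
Local Notation Xgrad f := (grad mu q setT f).
Local Notation pull := (pullback_grad mu nu p q phi).

Let p0 : (0 < p)%R. Proof. exact: lt_le_trans p1. Qed.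
Let bX : borel [set: X]. Proof. exact: measurableT. Qed.
Let bY : borel [set: Y]. Proof. exact: measurableT. Qed.

Lemma measurable_preimage B : borel B -> measurable (phi @^-1` B : set M).
Proof. by move=> bB; rewrite -[X in measurable X]setTI; exact: hphi. Qed.

Lemma Xgrad_measurable f : minimal_weak_upper_gradient mu q setT f (Xgrad f) ->
  measurable_fun [set: M] (Xgrad f : M -> \bar R).
Proof. by move=> [[[mg _] _] _ _]; exact: borel_caratheodory_fun (mms_borel hX) _ _ bX mg. Qed.

(** Pullback gradients are measurable but not known to be Borel, so [ae_le_energy] does not apply to
    them. Two domains are allowed in order to compare an integral over a preimage with one over
    [X]. *)
Lemma ae_le_energy_car (E E' : set X) g h :
  measurable (E : set M) -> measurable (E' : set M) ->
  measurable_fun [set: M] (g : M -> \bar R) -> (forall x, 0 <= g x) ->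
  measurable_fun [set: M] (h : M -> \bar R) -> (forall x, 0 <= h x) ->
  {ae (mu : set M -> \bar R), forall x, (g \_ E) x <= (h \_ E') x} ->
  energy mu q E g <= energy mu q E' h.
Proof.
move=> mE mE' mg g0 mh h0 gh.
rewrite -(setTI E) -(setTI E') -!energy_restrict//.
have mr (f : X -> \bar R) (D : set X) : measurable (D : set M) ->
    measurable_fun [set: M] (f : M -> \bar R) ->
    measurable_fun [set: M] (fun x : M => (f \_ D) x `^ q).
  move=> mD mf; apply: (measurableT_comp (measurable_poweR q)).
  by apply/(measurable_restrictT _ _).1 => //; exact: measurable_funTS.
apply: ae_ge0_le_integral => //.
- by move=> x _; exact: poweR_ge0.
- exact: mr.
- by move=> x _; exact: poweR_ge0.
- exact: mr.
- apply: ae_carS gh => x le _; apply: le_poweR => //; first exact: ltW.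
  by rewrite patchE; case: ifPn.
Qed.

Lemma composition_grad v : dirichlet nu p setT v -> Lip v ->
  [/\ minimal_weak_upper_gradient mu q setT (v \o phi) (Xgrad (v \o phi)),
      mu_measurable_fun mu setT (v \o phi),
      measurable_fun [set: M] (Xgrad (v \o phi) : M -> \bar R) &
      forall x, 0 <= Xgrad (v \o phi) x].
Proof.
move=> dv vL; have dX := hcomp.1 v dv vL.
have [mg _] := dirichlet_grad hX q0 bX dX; split => //; first exact: dX.1.
  exact: Xgrad_measurable.
by have [[[_ g0] _] _ _] := mg => x; exact: g0.
Qed.

(** Glue over annuli: at x use a Dirichlet function equal to [u] on the ball of radius n + 1, where
    n is the integer part of the distance from the base point to [phi x]. Locality shows that any
    other choice agrees almost everywhere. *)
Lemma pullback_gradP u : Lip u -> is_pullback_grad mu nu p q phi u (pull u).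
Proof.
move=> uL; pose y0 : Y := point.
have [v hv] := choice (fun n : nat => bounded_cutoff hY p0 y0 uL (ler0n R n.+1)).
pose N y := Num.truncn (mdist y0 y).
have Ny y : ball y0 (N y).+1%:R y.
  by rewrite ballEmdist/=; exact: truncnS_gt.
have vN y : v (N y) y = u y by have [_ _] := hv (N y); apply.
apply: (@xgetPex _ (cst +oo) [set g | is_pullback_grad mu nu p q phi u g]).
exists (fun x => Xgrad (v (N (phi x)) \o phi) x); split.
- move=> _ Z mZ; rewrite setTI.
  have -> : (fun x => Xgrad (v (N (phi x)) \o phi) x) @^-1` Z =
      \bigcup_n (phi @^-1` [set y | N y = n] `&` Xgrad (v n \o phi) @^-1` Z).
    apply/seteqP; split => [x Zx|x [n _ [/= Nn Zx]]]; last by rewrite /= Nn.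
    by exists (N (phi x)).
  apply: bigcupT_measurable => n; apply: measurableI.
    apply: measurable_preimage.
    have -> : [set y | N y = n] = ball y0 (n.+1%:R : R) `\` ball y0 (n%:R : R).
      apply/seteqP; split => y; rewrite !ballEmdist/=.
        move=> <-; split; first exact: truncnS_gt.
        by apply/negP; rewrite -leNgt truncn_le// mdist_ge0.
      move=> [yn /negP]; rewrite -leNgt => ny.
      by apply/eqP; rewrite truncn_eq ?mdist_ge0// ny yn.
    by apply: measurableD; apply: open_borel; exact: open_mball.
  have [vL dv _] := hv n; have [_ _ mg _] := composition_grad dv vL.
  by rewrite -[X in measurable X]setTI; exact: mg.
- by move=> x; have [vL dv _] := hv (N (phi x)); have [_ _ _] := composition_grad dv vL; apply.
- move=> G w oG bG dw wL wu.
  have [mw mmw _ _] := composition_grad dw wL.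
  have ae n : {ae (mu : set M -> \bar R), forall x,
      (v n \o phi) x = (1 * (w \o phi) x + 0)%R -> Xgrad (v n \o phi) x = Xgrad (w \o phi) x}.
    have [vL dv _] := hv n; have [mv mmv _ _] := composition_grad dv vL.
    exact: (@minimal_eq_on_affine _ _ mu hX q q0 (v n \o phi) (w \o phi) _ _ 1%R 0%R mv mw mmv mmw (normr1 _)).
  apply: ae_carS (ae_car_all ae) => x hx Gx; apply: hx.
  by rewrite /= mul1r addr0 vN wu.
Qed.

Lemma pullback_grad_comp u : dirichlet nu p setT u -> Lip u ->
  {ae (mu : set M -> \bar R), forall x, pull u x = Xgrad (u \o phi) x}.
Proof.
move=> du uL; have [_ _ h] := pullback_gradP uL.
have ae n : {ae (mu : set M -> \bar R), forall x,
    ball point (n.+1%:R : R) (phi x) -> pull u x = Xgrad (u \o phi) x}.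
  by apply: h => //; [exact: open_mball|exists point, n.+1%:R].
apply: ae_carS (ae_car_all ae) => x hx.
by apply: (hx (Num.truncn (mdist point (phi x)))); rewrite ballEmdist/=; exact: truncnS_gt.
Qed.

(** * The two inequalities between the norms *)

Lemma Lip0_supp U u : Lip0 U u -> supp u `<=` U.
Proof.
move=> [_ d0] y uy; apply: contrapT => nUy.
move: d0; rewrite ltNge => /negP; apply.
have -> : 0 = (mdist y y)%:E by rewrite mdistxx.
by apply: ereal_inf_lbound; exists y => //; exists y.
Qed.

Lemma Lip_cst (k : R) : Lip (fun _ : Y => k).
Proof. by exists 0%R => x y; rewrite subrr normr0 mul0r. Qed.

(** [Psi] is this supremum and [Phi] is [restricted_norm], both to the power sigma, so it suffices
    to compare the two before taking powers. *)
Definition pullback_sup U : \bar R :=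
  ereal_sup [set energy mu q (phi @^-1` U) (pull u) `^ q^-1
            | u in [set u | Lip u /\ energy nu p U (grad nu p setT u) <= 1]].

Lemma pullback_sup_ge0 U : open U -> 0 <= pullback_sup U.
Proof.
move=> oU; have bU := open_borel oU.
apply: (@le_trans _ _ (energy mu q (phi @^-1` U) (pull (fun=> 0%R)) `^ q^-1)).
  exact: poweR_ge0.
apply: ereal_sup_ubound; exists (fun=> 0%R) => //; split; first exact: Lip_cst.
have [wg lg ming] := Lip_grad hY p0 (Lip_cst 0).
have bN := mms_borel hY.
have w0 : weak_upper_gradient nu p setT (fun=> 0%R) (cst 0).
  apply: upper_gradient_weak => //; apply: upper_gradient_cst => // x y.
  by rewrite subrr normr0 mul0r.
have := ming _ w0 (locally_Lp_cst hY p (lexx 0%R)) => ae.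
apply: (@le_trans _ _ (energy nu p U (cst 0))).
  apply: ae_le_energy => //.
  - by apply: nonneg_borelS wg.1.
  - exact: nonneg_borel_cst.
  - by apply: ae_carS ae => x h _; exact: h.
by rewrite energy_cst// powR0 ?gt_eqF// mul0e.
Qed.

Lemma restricted_norm_le U : open U -> nu U < +oo ->
  restricted_norm mu nu p q phi U <= pullback_sup U.
Proof.
move=> oU Uoo; have bU := open_borel oU; have bN := mms_borel hY.
have [->|/eqP Soo] := eqVneq (pullback_sup U) +oo; first exact: leey.
have S0 := pullback_sup_ge0 oU.
have [s Ss] : exists s, pullback_sup U = s%:E.
  by move: S0 Soo; case: (pullback_sup U) => [s||]// _ _; exists s.
rewrite Ss; have s0 : (0 <= s)%R by rewrite -lee_fin -Ss.
apply: ereal_inf_lbound; exists s => //; split => // u dU u0.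
have uL := u0.1; have uU := Lip0_supp u0; have cu := Lip_continuous uL.
have dY := dirichlet_extend bN p0 oU cu uU dU.
have [[wU lU _] AU] := dirichlet_grad hY p0 bU dU.
have [mY _] := dirichlet_grad hY p0 bY dY.
have [wY _ minY] := mY.
set gU := grad nu p U u in wU lU AU *; set gY := grad nu p setT u in mY wY minY *.
have bS : borel (supp u) by apply: closed_borel; exact: closed_closure.
have wext := weak_upper_gradient_extend bN p0 oU cu uU wU.
have extoo : energy nu p setT (gU \_ (supp u)) <= energy nu p U gU.
  by rewrite energy_restrict// setTI; apply: energyS => //; exact: wU.1.
have eY : energy nu p setT gY <= energy nu p U gU.
  apply: (le_trans _ extoo); apply: ae_le_energy => //; [exact: wY.1|exact: wext.1|].
  apply: minY => //.
  apply: energy_lty_locally_Lp => //; [exact: wext.1|exact: le_lt_trans extoo AU].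
have [mX mmX mgX gX0] := composition_grad dY uL.
have A0 : 0 <= energy nu p U gU by exact: energy_ge0.
(* A function of zero energy cannot be normalized; in that case boundedness of the composition
   operator on [Y] makes the left side zero. *)
move: A0; rewrite le_eqVlt => /predU1P[Az|A0].
  have [C hC] := hcomp.2; apply: le_trans (hC u dY uL) _.
  have -> : grad_norm nu p setT u = 0.
    rewrite /grad_norm; have -> : energy nu p setT gY = 0.
      by apply/eqP; rewrite eq_le energy_ge0 andbT Az.
    by rewrite poweR0r// invr_eq0 gt_eqF.
  by rewrite mule0 mule_ge0 ?poweR_ge0.
have Afin : energy nu p U gU \is a fin_num by rewrite ge0_fin_numE// ltW.
pose a := fine (energy nu p U gU).
have aE : energy nu p U gU = a%:E by rewrite fineK.
have a0 : (0 < a)%R by rewrite -lte_fin -aE.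
(* [b] is the gradient norm of [u] on [U]; dividing by it gives the competitor [u'] in the
   supremum. *)
pose b := (a `^ p^-1)%R.
have b0 : (0 < b)%R by exact: powR_gt0.
have bi0 : (0 <= b^-1)%R by rewrite invr_ge0 ltW.
have bp : (b `^ p = a)%R by rewrite /b -powRrM mulVf ?gt_eqF// powRr1// ltW.
pose u' y := (b^-1 * u y)%R.
have u'L : Lip u' by exact: LipZ.
have mY' := Lip_grad hY p0 u'L.
have [wY' _ _] := mY'.
have e' : energy nu p U (grad nu p setT u') <= 1.
  apply: (@le_trans _ _ (energy nu p U (fun y => (b^-1)%:E * gY y))).
    apply: ae_le_energy => //.
    - by apply: nonneg_borelS wY'.1.
    - by apply: nonneg_borelZ => //; apply: nonneg_borelS wY.1.
    - have := grad_scale_le hY p0 mY mY' bi0 (fun=> erefl).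
      by apply: ae_carS.
  rewrite energyZ//; last by apply: nonneg_borelS wY.1.
  apply: (@le_trans _ _ ((b^-1 `^ p)%:E * a%:E)).
    rewrite lee_wpmul2l ?lee_fin ?powR_ge0// -aE; apply: le_trans eY.
    by apply: energyS => //; exact: wY.1.
  by rewrite -EFinM -[X in (_ * X)%:E]bp -powRM ?(ltW b0)// mulVf ?gt_eqF// powR1.
have valS : energy mu q (phi @^-1` U) (pull u') `^ q^-1 <= s%:E.
  by rewrite -Ss; apply: ereal_sup_ubound; exists u'.
have dY' : dirichlet nu p setT u'.
  have u'U : supp u' `<=` U.
    apply: subset_trans uU; apply: supp_sub; first exact: closed_closure.
    move=> y u'y; apply: subset_closure => /=; apply/eqP => uy; apply: u'y.
    by rewrite /u' uy mulr0.
  by apply: (dirichlet_extend bN p0 oU (Lip_continuous u'L) u'U); exact: Lip_dirichlet.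
have [mX' _ mgX' gX'0] := composition_grad dY' u'L.
have [mpull pull0 _] := pullback_gradP u'L.
have mV := measurable_preimage bU.
have le1 : energy mu q setT (Xgrad (u \o phi)) <=
    energy mu q (phi @^-1` U) (fun x => b%:E * pull u' x).
  apply: ae_le_energy_car => //.
  - exact: measurable_funeM.
  - by move=> x; rewrite mule_ge0// lee_fin ltW.
  have ae1 := pullback_grad_comp dY' u'L.
  have ae2 : {ae (mu : set M -> \bar R), forall x,
      Xgrad (u \o phi) x <= b%:E * Xgrad (u' \o phi) x}.
    apply: (grad_scale_le hX q0 mX' mX (ltW b0)) => x.
    by rewrite /= /u' mulrA divff ?mul1r// gt_eqF.
  (* Locality against the zero function; it applies off the preimage of [U], where [u \o phi]
     vanishes. *)
  have ae3 : {ae (mu : set M -> \bar R), forall x,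
      (u \o phi) x = 0%R -> Xgrad (u \o phi) x <= cst 0 x}.
    have w0 : weak_upper_gradient mu q setT (fun=> 0%R) (cst 0).
      apply: upper_gradient_weak => //; first exact: (mms_borel hX).
      by apply: upper_gradient_cst => // x y; rewrite subrr normr0 mul0r.
    apply: (minimal_le_on_eq hX q0 mX w0) => //; first exact: locally_Lp_cst.
    exact: measurable_cst.
  apply: ae_carS (ae_car_and ae1 (ae_car_and ae2 ae3)) => x [h1 [h2 h3]].
  rewrite !patchE mem_set//; case: ifPn => [_|/negP nU]; first by rewrite h1.
  apply: h3; apply: contrapT => ux; apply: nU; apply/mem_set/uU.
  by apply: subset_closure; exact/eqP.
have le2 : energy mu q (phi @^-1` U) (fun x => b%:E * pull u' x) =
    (b `^ q)%:E * energy mu q (phi @^-1` U) (pull u').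
  rewrite /energy -ge0_integralZl//.
  - by apply: eq_integral => x _; rewrite poweRM// ?lee_fin ?(ltW b0)// poweR_EFin.
  - by apply: (measurableT_comp (measurable_poweR q)); exact: measurable_funTS.
  - by move=> x _; exact: poweR_ge0.
  - by rewrite lee_fin powR_ge0.
rewrite /grad_norm -/gU aE poweR_EFin -/b.
have qi0 : (0 <= q^-1)%R by rewrite invr_ge0 ltW.
rewrite le2 in le1; apply: le_trans (le_poweR qi0 (energy_ge0 _ _ _ _) le1) _.
rewrite poweRM ?lee_fin ?powR_ge0 ?energy_ge0// poweR_EFin -powRrM mulfV ?gt_eqF//.
by rewrite powRr1 ?(ltW b0)// muleC lee_wpmul2r// lee_fin ltW.
Qed.

Lemma interior_set_closed (U : set Y) (d : R) :
  closed [set y | forall z, ~ U z -> (d <= mdist y z)%R].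
Proof.
have -> : [set y | forall z, ~ U z -> (d <= mdist y z)%R] =
    \bigcap_(z in ~` U) [set y | (d <= mdist z y)%R].
  by apply/seteqP; split => y h z nUz /=; have := h z nUz; rewrite /= metric_sym.
by apply: closed_bigI => z _; exact: closed_mdist_ge.
Qed.

(* Replacing u by a sawtooth of amplitude e composed with u does not change
   the gradient but makes the function small, so that cutting it off near the
   complement of U costs only e / d in the gradient, hence a multiple of
   (e / d)^p nu(U) in the energy. *)
Lemma pullback_energy_interior (U : set Y) u (C d t : R) : open U ->
  nu U < +oo -> Lip u -> energy nu p U (grad nu p setT u) <= 1 -> (0 <= C)%R ->
  (forall v, dirichlet nu p U v -> Lip0 U v ->
     grad_norm mu q setT (v \o phi) <= C%:E * grad_norm nu p U v) ->
  (0 < d)%R -> (0 < t)%R ->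
  energy mu q (phi @^-1` [set y | forall z, ~ U z -> (2 * d <= mdist y z)%R])
    (pull u) `^ q^-1 <= (C * (1 + t) ^+ 2)%:E.
Proof.
move=> oU Uoo uL u1 C0 hC d0 t0; have bU := open_borel oU; have bN := mms_borel hY.
set G := [set y | _].
have nU0 : 0 <= nu U by exact: outer_measure_ge0.
have nUfin : nu U \is a fin_num by rewrite ge0_fin_numE.
pose m := fine (nu U); have m0 : (0 <= m)%R by rewrite fine_ge0.
have ti0 : (0 < 1 + t^-1)%R by rewrite addr_gt0// invr_gt0.
(* The choice makes the second term of [energyD_le], (1 + 1 / t)^p (e / d)^p nu(U), equal to t m /
   (m + 1), hence at most t; m + 1 is used since m may be 0. *)
pose y := ((t / (m + 1)) `^ p^-1)%R.
have tm0 : (0 < t / (m + 1))%R by rewrite divr_gt0// ltr_wpDl.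
have yp0 : (0 < y)%R by exact: powR_gt0.
pose e := (y / (1 + t^-1) * d)%R.
have e0 : (0 < e)%R by rewrite mulr_gt0// divr_gt0.
have ed : (e / d = y / (1 + t^-1))%R by rewrite /e mulfK// gt_eqF.
have [f [s [c [fL f01 s1 fsc]]]] := sawtooth e0.
have [psi [psi01 psiL psiG psiU]] := interior_cutoff U d0 (ltW e0).
(* Both functions lie between 0 and e. Where the cutoff is at its full height e, in particular on
   [G], the minimum is the sawtooth of [u]. *)
pose v z := Num.min (f (u z)) (psi z).
have minL (a b a' b' : R) : (`|Num.min a b - Num.min a' b'| <= `|a - a'| + `|b - b'|)%R.
  have := ler_norm (a - a'); have := ler_norm (a' - a).
  have := ler_norm (b - b'); have := ler_norm (b' - b).
  rewrite (distrC b') (distrC a') => h1 h2 h3 h4; rewrite ler_norml.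
  by rewrite /Num.min; case: ifPn => ?; case: ifPn => ?; apply/andP; split; lra.
have vuL z w : (`|v z - v w| <= `|u z - u w| + `|psi z - psi w|)%R.
  by apply: le_trans (minL _ _ _ _) _; rewrite lerD2r.
have [K K0 uK] := Lip_gt0 uL.
have vL : Lip v.
  exists (K + e / d)%R => z w; apply: le_trans (vuL z w) _.
  by rewrite mulrDl lerD.
have v0psi z : v z <> 0%R -> psi z <> 0%R.
  apply: contra_not => pz; rewrite /v pz; apply/min_idPr.
  by case/andP: (f01 (u z)).
have vsupp : supp v `<=` [set z | forall w, ~ U w -> (d <= mdist z w)%R].
  apply: supp_sub; first exact: interior_set_closed.
  by move=> z /v0psi; exact: psiU.
have v0 : Lip0 U v.
  split => //; apply: (@lt_le_trans _ _ d%:E); first by rewrite lte_fin.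
  by apply: le_ereal_inf_tmp => _ [z vz [w nUw <-]]; rewrite lee_fin; exact: vsupp.
have vU := Lip0_supp v0.
have dU := Lip_dirichlet hY p oU Uoo vL.
have dY := dirichlet_extend bN p0 oU (Lip_continuous vL) vU dU.
have [[wU lU minU] _] := dirichlet_grad hY p0 bU dU.
have [wu lu _] := Lip_grad hY p0 uL.
have ed0 : (0 <= e / d)%R by rewrite divr_ge0// ltW.
have psiwU : weak_upper_gradient nu p U psi (cst (e / d)%:E).
  by apply: upper_gradient_weak => //; exact: upper_gradient_cst.
have uwU : weak_upper_gradient nu p U u (grad nu p setT u).
  by apply: weak_upper_gradientS wu.
have wvU := weak_upper_gradient_lipschitz2 bN p0 bU vuL uwU psiwU.
have cstoo : energy nu p U (cst (e / d)%:E) < +oo.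
  by rewrite energy_cst// lte_mul_pinfty ?lee_fin ?powR_ge0.
have lvU : locally_Lp nu p U (fun z => grad nu p setT u z + cst (e / d)%:E z).
  apply: energy_lty_locally_Lp => //; first exact: wvU.1.
  apply: energyD_lty => //; [exact: uwU.1|exact: psiwU.1|exact: le_lt_trans u1 (ltry _)].
(* The bound (1 + t)^p + t is rounded up to a single power, whose p-th root is at most (1 + t)^2
   because p >= 1. *)
have eU : energy nu p U (grad nu p U v) <= ((1 + t) `^ (p + 1))%:E.
  apply: (@le_trans _ _ (energy nu p U (fun z => grad nu p setT u z + cst (e / d)%:E z))).
    by apply: ae_le_energy => //; [exact: wU.1|exact: wvU.1|exact: minU].
  apply: le_trans (energyD_le bN p0 bU uwU.1 psiwU.1 t0) _.
  apply: (@le_trans _ _ (((1 + t) `^ p)%:E + t%:E)).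
    apply: leeD; first by rewrite -[leRHS]mule1 lee_wpmul2l// lee_fin powR_ge0.
    rewrite energy_cst// -(fineK nUfin) -/m -!EFinM lee_fin mulrA -powRM ?(ltW ti0)//.
    rewrite ed mulrCA divff ?gt_eqF// mulr1 /y -powRrM mulVf ?gt_eqF// powRr1 ?(ltW tm0)//.
    by rewrite -mulrA ler_piMr ?(ltW t0)// mulrC ler_pdivrMr ?mul1r ?lerDl// ltr_wpDl.
  have t1 : (1 <= 1 + t)%R by rewrite lerDl ltW.
  have h1 : (1 <= (1 + t) `^ p)%R by have := ler_powR t1 (ltW p0); rewrite powRr0.
  rewrite -EFinD lee_fin powRD; last by apply/implyP => _; rewrite gt_eqF// (lt_le_trans ltr01).
  rewrite powRr1; last by rewrite (le_trans ler01).
  by rewrite mulrDr mulr1 lerD2l ler_peMl// ltW.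
have [mv mmv mgv gv0] := composition_grad dY vL.
have [mpull pull0 pullG] := pullback_gradP uL.
(* Locality needs Dirichlet functions on [X], so [u] is replaced by its cutoffs [w n]: on a ball [u]
   and [w n] agree, and on [G] the function [v] is an affine branch of slope 1 or -1 applied to [u].
   Countably many pairs (n, i) suffice. *)
have ae_eq : {ae (mu : set M -> \bar R), forall x, G (phi x) -> pull u x = Xgrad (v \o phi) x}.
  pose y0 : Y := point.
  have [w hw] := choice (fun n : nat => bounded_cutoff hY p0 y0 uL (ler0n R n.+1)).
  have ae1 n : {ae (mu : set M -> \bar R), forall x,
      ball y0 (n.+1%:R : R) (phi x) -> pull u x = Xgrad (w n \o phi) x}.
    have [wL dw wu'] := hw n.
    by apply: pullG => //; [exact: open_mball|exists y0, n.+1%:R].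
  have ae2 n : {ae (mu : set M -> \bar R), forall x, forall i,
      (v \o phi) x = (s i * (w n \o phi) x + c i)%R -> Xgrad (v \o phi) x = Xgrad (w n \o phi) x}.
    have [wL dw _] := hw n; have [mw mmw _ _] := composition_grad dw wL.
    by apply: ae_car_all => i; exact: (@minimal_eq_on_affine _ _ mu hX q q0 (v \o phi) (w n \o phi) _ _ (s i) (c i) mv mw mmv mmw (s1 i)).
  apply: ae_carS (ae_car_and (ae_car_all ae1) (ae_car_all ae2)) => x [h1 h2] Gx.
  pose n := Num.truncn (mdist y0 (phi x)).
  have bn : ball y0 (n.+1%:R : R) (phi x) by rewrite ballEmdist/=; exact: truncnS_gt.
  have [_ _ wn] := hw n; have [i fi] := fsc (u (phi x)).
  rewrite (h1 n bn); apply/esym/(h2 n i).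
  rewrite /= (wn _ bn) -fi /v (psiG _ Gx); apply/min_idPl.
  by case/andP: (f01 (u (phi x))).
have mG : measurable (phi @^-1` G : set M).
  by apply: measurable_preimage; apply: closed_borel; exact: interior_set_closed.
have qi0 : (0 <= q^-1)%R by rewrite invr_ge0 ltW.
have pi0 : (0 <= p^-1)%R by rewrite invr_ge0 ltW.
have le1 : energy mu q (phi @^-1` G) (pull u) <= energy mu q setT (Xgrad (v \o phi)).
  apply: ae_le_energy_car => //.
  apply: ae_carS ae_eq => x hx; rewrite !patchE [x \in setT]mem_set//.
  by case: ifPn => [/set_mem/hx ->|_].
apply: le_trans (le_poweR qi0 (energy_ge0 _ _ _ _) le1) _.
apply: le_trans (hC v dU v0) _.
rewrite EFinM lee_wpmul2l ?lee_fin//.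
apply: le_trans (le_poweR pi0 (energy_ge0 _ _ _ _) eU) _.
rewrite poweR_EFin lee_fin -powRrM -powR_mulrn ?addr_ge0 ?(ltW t0)//.
apply: ler_powR; first by rewrite lerDl ltW.
by rewrite ler_pdivrMr// mulr_natl mulr2n lerD2l.
Qed.

(** Exhaust [U] by the sets [G n] at distance at least 2 / (n + 1) from its complement. For fixed n
    let t tend to 0 in [pullback_energy_interior], then let n grow by monotone convergence. *)
Lemma pullback_sup_le (U : set Y) : open U -> nu U < +oo ->
  pullback_sup U <= restricted_norm mu nu p q phi U.
Proof.
move=> oU Uoo; apply: ge_ereal_sup => _ [u [uL u1] <-].
apply: le_ereal_inf_tmp => _ [C [C0 hC] <-].
have [mpull pull0 _] := pullback_gradP uL.
pose G n := [set y | forall z, ~ U z -> (2 * n.+1%:R^-1 <= mdist y z)%R].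
have mG n : measurable (phi @^-1` G n : set M).
  by apply: measurable_preimage; apply: closed_borel; exact: interior_set_closed.
have UG : phi @^-1` U = \bigcup_n (phi @^-1` G n).
  apply/seteqP; split => [x /= Ux|x [n _ /= Gx]].
    have := oU; rewrite openE => /(_ _ Ux) /nbhs_ballP[r /= r0 rU].
    exists (Num.truncn (2 / r)%R) => //= z nUz; rewrite leNgt; apply/negP => lt.
    apply: nUz; apply: rU; rewrite ballEmdist/=; apply: lt_trans lt _.
    by rewrite ltr_pdivrMr ?ltr0n// mulrC -ltr_pdivrMr//; exact: truncnS_gt.
  apply: contrapT => nU; have := Gx _ nU; rewrite mdistxx leNgt.
  by rewrite mulr_gt0// invr_gt0.
have homoG : {homo (fun n => phi @^-1` G n) : n m / (n <= m)%N >-> (n <= m)%O}.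
  move=> n m nm; apply/subsetPset => x /= h z nUz; apply: le_trans (h z nUz).
  by rewrite ler_wpM2l// lef_pV2 ?posrE// ler_nat.
have each n : energy mu q (phi @^-1` G n) (pull u) <= (C `^ q)%:E.
  have n0 : (0 < n.+1%:R^-1 :> R)%R by rewrite invr_gt0.
  have le1 : energy mu q (phi @^-1` G n) (pull u) `^ q^-1 <= C%:E.
    apply/lee_addgt0Pr => e e0.
    have C1 : (0 < 3 * C + 1)%R by lra.
    (* For t <= 1 one has (1 + t)^2 <= 1 + 3 t, so the error is at most 3 C t <= e; adding 1 to the
       denominator covers C = 0. *)
    pose t := Num.min 1%R (e / (3 * C + 1))%R.
    have t0 : (0 < t)%R by rewrite /t lt_min ltr01 divr_gt0.
    have t1 : (t <= 1)%R by rewrite /t ge_min lexx.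
    have te : (t * (3 * C + 1) <= e)%R by rewrite -ler_pdivlMr// /t ge_min lexx orbT.
    apply: le_trans (pullback_energy_interior oU Uoo uL u1 C0 hC n0 t0) _.
    by rewrite -EFinD lee_fin; nra.
  have -> : energy mu q (phi @^-1` G n) (pull u) =
      (energy mu q (phi @^-1` G n) (pull u) `^ q^-1) `^ q.
    by rewrite -poweRrM mulVf ?gt_eqF// poweRe1// energy_ge0.
  by rewrite -poweR_EFin; apply: le_poweR => //; [exact: ltW|exact: poweR_ge0].
have le : energy mu q (phi @^-1` U) (pull u) <= (C `^ q)%:E.
  have mf (D : set M) : measurable_fun D (fun x : M => pull u x `^ q).
    apply: (measurableT_comp (measurable_poweR q)); exact: measurable_funTS.
  have cv := @ge0_nondecreasing_set_cvg_integral _ M R (fun n => phi @^-1` G n)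
    (fun x => pull u x `^ q) (mu : {measure set M -> \bar R}) homoG mG (fun n => mf _)
    (fun n x _ => poweR_ge0 _ _).
  rewrite /energy UG -(cvg_lim _ cv)//.
  by apply: lime_le; [apply/cvg_ex; eexists; exact: cv|apply: nearW; exact: each].
apply: (@le_trans _ _ ((C `^ q)%:E `^ q^-1)).
  by apply: le_poweR; rewrite ?invr_ge0 ?(ltW q0)// energy_ge0.
by rewrite poweR_EFin -powRrM divff ?gt_eqF// powRr1.
Qed.

End composition.

Theorem proposition3p3 (R : realType) (X Y : pmetricType R)
  (mu : {outer_measure set X -> \bar R})
  (nu : {outer_measure set Y -> \bar R})
  (hX : metric_measure_space mu) (hY : metric_measure_space nu)
  (p q sigma : R) (hq : 1 <= q) (hqp : q < p)
  (hsigma : sigma^-1 = q^-1 - p^-1)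
  (phi : X -> Y) (hphi : measurable_mapping mu phi)
  (hcomp : induces_bounded_composition mu nu p q phi) :
  forall U : set Y, open U -> (nu U < +oo)%E ->
    Phi mu nu p q phi sigma U = Psi mu nu p q phi sigma U.
Proof.
move=> U oU Uoo.
have q0 : 0 < q by rewrite (lt_le_trans ltr01).
have p1 : 1 <= p by rewrite (le_trans hq)// ltW.
rewrite /Phi /Psi; congr (_ `^ sigma)%E; apply/eqP; rewrite eq_le.
apply/andP; split; first exact: (restricted_norm_le hX hY p1 q0 hphi hcomp).
exact: (pullback_sup_le hX hY p1 q0 hphi hcomp).
Qed.
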